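(* Let a Lie group $G$ act on a smooth manifold $X$. Let $V$ be a real finite dimensional representation of $G$. Suppose that $G$ preserves the Haar measure on $V$. Let $U\subset V$ be an open non-empty $G$-invariant subset. Let $\chi$ be a character of $G$. Suppose that $\mathcal{D}(X\times U)^{G,\chi}=0$. Then for every $k\in\mathbb{Z}_{\ge 0}$, $\mathcal{D}(X,\mathrm{Sym}^k(V))^{G,\chi}=0$.
   Context: For a smooth manifold $X$, $\mathcal{D}(X)=C_c^\infty(X)^*$ is the space of distributions (continuous dual of smooth compactly supported complex-valued functions). For a finite dimensional real vector space $L$, $\mathcal{D}(X,L)$ is the continuous dual of the space $C_c^\infty(X,L)$ of smooth compactly supported sections of the complexified trivial bundle $X\times L$; when $L$ is a representation of $G$, this bundle is $G$-equivariant via the diagonal action. $G$ acts diagonally on $X\times U$. The superscript $G,\chi$ denotes the subspace of those $\xi$ with $g\xi=\chi(g)\xi$ for all $g\in G$. *)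

(* Defs.v *)
From HB Require Import structures.
From mathcomp Require Import all_boot all_order all_algebra.
From mathcomp Require Import all_classical all_reals all_analysis.
From mathcomp.real_closed Require Import complex.
From mathcomp Require Import -(notations) mpoly.
Set Implicit Arguments.
Unset Strict Implicit.
Unset Printing Implicit Defensive.
Import Order.TTheory GRing.Theory Num.Theory.
Import numFieldNormedType.Exports.
Local Open Scope classical_set_scope.
Local Open Scope ring_scope.
Local Open Scope complex_scope.

(* No compatibility is imposed here; see [lie_group]. *)
#[short(type="groupTopologicalType")]
HB.structure Definition GroupTopological := {G of Group G & Topological G}.

Section Smooth.
Context {R : realType}.

Definition dirD n (W : normedModType R) (vs : seq 'cV[R]_n)
    (f : 'cV[R]_n -> W) : 'cV[R]_n -> W :=
  foldr (fun v h => 'D_v h) f vs.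

(* Meant for [O] open: all iterated directional derivatives exist and are
   continuous on [O]. *)
Definition smooth_on n (W : normedModType R) (O : set 'cV[R]_n)
    (f : 'cV[R]_n -> W) : Prop :=
  forall (vs : seq 'cV[R]_n) (v x : 'cV[R]_n), O x ->
    derivable (dirD vs f) x v /\ {for x, continuous (dirD vs f)}.

(* [cfun] is only relevant on [cdom], and [cinv] on the image of [cdom]. *)
Record chart (T : topologicalType) (n : nat) := Chart {
  cdom : set T;
  cfun : T -> 'cV[R]_n;
  cinv : 'cV[R]_n -> T }.

Definition ccod T n (phi : chart T n) : set 'cV[R]_n := cfun phi @` cdom phi.

Definition is_chart T n (phi : chart T n) : Prop :=
  [/\ open (cdom phi), open (ccod phi),
      {in cdom phi, cancel (cfun phi) (cinv phi)},
      {within cdom phi, continuous (cfun phi)} &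
      {within ccod phi, continuous (cinv phi)}].

Definition smooth_manifold (T : topologicalType) n (A : set (chart T n)) : Prop :=
  [/\ hausdorff_space T, @second_countable T,
      forall phi, A phi -> is_chart phi,
      forall x : T, exists2 phi, A phi & cdom phi x &
      forall phi psi, A phi -> A psi ->
        smooth_on (cfun phi @` (cdom phi `&` cdom psi)) (cfun psi \o cinv phi)].

Definition prod_chart S m T n (phi : chart S m) (psi : chart T n) :
    chart (S * T)%type (m + n) :=
  Chart (cdom phi `*` cdom psi)
        (fun p => col_mx (cfun phi p.1) (cfun psi p.2))
        (fun y => (cinv phi (usubmx y), cinv psi (dsubmx y))).

Definition prod_atlas S m T n (A : set (chart S m)) (B : set (chart T n)) :
    set (chart (S * T)%type (m + n)) :=
  [set chi | exists phi psi, [/\ A phi, B psi & chi = prod_chart phi psi]].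

Definition euclid_atlas n : set (chart 'cV[R]_n n) := [set Chart setT id id].

Definition smooth_map S m T n (A : set (chart S m)) (B : set (chart T n))
    (f : S -> T) : Prop :=
  continuous f /\
  forall phi psi, A phi -> B psi ->
    smooth_on (cfun phi @` (cdom phi `&` f @^-1` cdom psi))
              (cfun psi \o f \o cinv phi).

Definition lie_group (G : groupTopologicalType) d (A : set (chart G d)) : Prop :=
  [/\ smooth_manifold A,
      smooth_map (prod_atlas A A) A (fun p => (p.1 * p.2)%g) &
      smooth_map A A (fun g : G => (g^-1)%g)].

Definition smooth_action (G : groupTopologicalType) d (AG : set (chart G d))
    (X : topologicalType) n (AX : set (chart X n)) (a : G -> X -> X) : Prop :=
  [/\ forall x, a 1%g x = x,
      forall g h x, a (g * h)%g x = a g (a h x) &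
      smooth_map (prod_atlas AG AX) AX (fun p => a p.1 p.2)].

Definition representation (G : groupTopologicalType) m
    (rho : G -> 'M[R]_m) : Prop :=
  [/\ rho 1%g = 1%:M,
      forall g h, rho (g * h)%g = rho g *m rho h &
      continuous rho].

Definition is_character (G : groupTopologicalType) (chi : G -> R[i]) : Prop :=
  [/\ chi 1%g = 1,
      forall g h, chi (g * h)%g = chi g * chi h &
      continuous (chi : G -> R[i]^o)].

End Smooth.
Arguments chart R T n : clear implicits.
Arguments euclid_atlas R n : clear implicits.

Section Haar.
Context {R : realType} {m : nat}.

Definition borelV := g_sigma_algebraType (@open 'cV[R]_m).

Definition is_haar (mu : {measure set borelV -> \bar R}) : Prop :=
  [/\ forall (v : 'cV[R]_m) (B : set borelV), measurable B ->
        mu [set (v + w : 'cV[R]_m) | w in (B : set 'cV[R]_m)] = mu B,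
      forall K : set 'cV[R]_m, compact K -> (mu K < +oo)%E &
      mu setT != 0%E].

Definition preserves_measure (G : Type) (rho : G -> 'M[R]_m)
    (mu : {measure set borelV -> \bar R}) : Prop :=
  forall (g : G) (B : set borelV), measurable B ->
    mu [set (rho g *m w : 'cV[R]_m) | w in (B : set 'cV[R]_m)] = mu B.

End Haar.
Arguments borelV R m : clear implicits.

Local Notation Re := complex.Re.
Local Notation Im := complex.Im.

Section Complexification.
Context {R : realType}.

(* [(a, b)] stands for [a + i b]. *)
Definition cplx (L : lmodType R) : Type := (L * L)%type.

Variable L : lmodType R.
HB.instance Definition _ := GRing.Zmodule.on (cplx L).

Definition cplx_scale (c : R[i]) (z : cplx L) : cplx L :=
  (Re c *: z.1 - Im c *: z.2, Re c *: z.2 + Im c *: z.1).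

Lemma cplx_scaleA a b z :
  cplx_scale a (cplx_scale b z) = cplx_scale (a * b) z.
Proof.
case: a b z => [a1 a2] [b1 b2] [u v]; rewrite /cplx_scale /=; congr pair.
  rewrite scalerBr scalerDr !scalerA scalerBl scalerDl !opprD -!addrA.
  by congr (_ + _); rewrite addrA addrC.
rewrite scalerBr scalerDr !scalerA scalerBl scalerDl -!addrA.
by congr (_ + _); rewrite addrA addrC.
Qed.

Lemma cplx_scale1 : left_id 1 cplx_scale.
Proof. by case=> u v; rewrite /cplx_scale /= !scale1r !scale0r subr0 addr0. Qed.

Lemma cplx_scaleDr : right_distributive cplx_scale +%R.
Proof.
move=> c [u v] [u' v']; rewrite /cplx_scale /=; congr pair => /=.
  by rewrite !scalerDr opprD addrACA.
by rewrite !scalerDr addrACA.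
Qed.

Lemma cplx_scaleDl z : {morph cplx_scale^~ z : a b / a + b}.
Proof.
move=> [a1 a2] [b1 b2]; rewrite /cplx_scale /=; congr pair => /=.
  by rewrite !scalerDl opprD addrACA.
by rewrite !scalerDl addrACA.
Qed.

HB.instance Definition _ := GRing.Zmodule_isLmodule.Build R[i] (cplx L)
  cplx_scaleA cplx_scale1 cplx_scaleDr cplx_scaleDl.

Definition cplx_map (s : L -> L) (z : cplx L) : cplx L := (s z.1, s z.2).

End Complexification.

Section SymmetricPower.
Context {R : realType} (m k : nat).

(* Homogeneous polynomials of degree [k] in the vectors ['X_j] of the standard
   basis of the column space ['cV[R]_m]. *)
Definition Sym : lmodType R := dhomog m R k.

(* [A] maps the j-th basis vector to [\sum_i A i j 'X_i]. *)
Definition sym_basis_img (A : 'M[R]_m) : m.-tuple (mpoly m R) :=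
  [tuple \sum_(i < m) A i j *: mpolyX R (mnm1 i) | j < m].

Lemma sym_map_homog (A : 'M[R]_m) (p : Sym) :
  comp_mpoly (sym_basis_img A) (val p)
    \is ishomog1 k (@mdeg m).
Proof.
rewrite comp_mpolyEX big_seq; apply: rpred_sum => e ep.
apply: rpredZ; rewrite comp_mpolyX.
have -> : k = (\sum_(i < m) e i)%N.
  by rewrite -mdegE (dhomog_mf (valP p) ep).
elim/big_rec2: _ => [|i d q _ hq]; first exact: dhomog1.
apply: dhomogM hq; rewrite -[X in ishomog1 X]mul1n.
apply: dhomogMn; rewrite tnth_mktuple; apply: rpred_sum => j _.
by apply: rpredZ; rewrite dhomogX /= mdeg1.
Qed.

Definition sym_map (A : 'M[R]_m) (p : Sym) : Sym :=
  DHomog (sym_map_homog A p).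

End SymmetricPower.
Arguments Sym R m k : clear implicits.

Section Distributions.
Context {R : realType} {T : topologicalType} {n : nat}.
Variables (A : set (chart R T n)) (O : set T) (E : lmodType R[i]).

(* [E] is meant to be finite dimensional. As [l] ranges over the complex-linear
   forms, [Re \o l] ranges over all the real-linear ones, so [E]-valued functions
   are smooth when all their [local_rep] are. *)
Definition local_rep (phi : chart R T n) (l : {linear E -> R[i]^o}) (f : T -> E)
    (y : 'cV[R]_n) : R^o :=
  Re (l (f (cinv phi y))).

Definition vanishes_off (K : set T) (f : T -> E) : Prop :=
  forall x, ~ K x -> f x = 0.

(* Elements of C_c^infty(O, E), extended by zero outside the open set [O]. *)
Definition test_function (f : T -> E) : Prop :=
  (forall phi l, A phi -> smooth_on (ccod phi) (local_rep phi l f)) /\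
  exists K, [/\ compact K, K `<=` O & vanishes_off K f].

Record seminorm := Seminorm {
  sn_chart : chart R T n;
  sn_set : set 'cV[R]_n;
  sn_form : {linear E -> R[i]^o};
  sn_dirs : seq 'cV[R]_n }.

Definition is_seminorm (q : seminorm) : Prop :=
  [/\ A (sn_chart q), compact (sn_set q) & sn_set q `<=` ccod (sn_chart q)].

(* The supremum of the absolute value below over [sn_set q] is less than [e],
   since it is attained when [sn_set q] is nonempty. *)
Definition seminorm_lt (q : seminorm) (f : T -> E) (e : R) : Prop :=
  forall y, sn_set q y ->
    `|dirD (sn_dirs q) (local_rep (sn_chart q) (sn_form q) f) y| < e.

Definition absolutely_convex (B : set (T -> E)) : Prop :=
  forall f g (a b : R[i]), B f -> B g -> `|a| + `|b| <= 1 ->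
    B (a *: f + b *: g).

(* Neighbourhoods of 0 for the locally convex inductive limit, over the compact
   subsets [K] of [O], of the Frechet spaces C_K^infty(O, E). *)
Definition test_nbhs0 (W : set (T -> E)) : Prop :=
  exists B, [/\ B `<=` W, absolutely_convex B &
    forall K, compact K -> K `<=` O ->
      exists N (q : 'I_N -> seminorm) (e : R),
        [/\ forall j, is_seminorm (q j), 0 < e &
            forall f, test_function f -> vanishes_off K f ->
              (forall j, seminorm_lt (q j) f e) -> B f]].

(* Distributions are encoded as functionals defined on all functions, of which
   only the values at test functions matter. *)
Definition distribution (xi : (T -> E) -> R[i]) : Prop :=
  (forall f g (c : R[i]), test_function f -> test_function g ->
     xi (c *: f + g) = c * xi f + xi g) /\
  (forall f, test_function f -> forall e : R, 0 < e ->
     test_nbhs0 [set h | test_function h /\ `|xi (f + h) - xi f| < e%:C]).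

Section Equivariance.
Variables (G : groupTopologicalType) (a : G -> T -> T) (s : G -> E -> E).

Definition act_fun (g : G) (f : T -> E) : T -> E :=
  fun x => s g (f (a g^-1%g x)).

Definition act_dist (g : G) (xi : (T -> E) -> R[i]) : (T -> E) -> R[i] :=
  fun f => xi (act_fun g^-1%g f).

Definition equivariant_distributions (chi : G -> R[i]) :
    set ((T -> E) -> R[i]) :=
  [set xi | distribution xi /\
     forall g f, test_function f -> act_dist g xi f = chi g * xi f].

Definition equivariant_distributions_vanish (chi : G -> R[i]) : Prop :=
  forall xi, equivariant_distributions chi xi ->
    forall f, test_function f -> xi f = 0.

End Equivariance.
End Distributions.

(* Main.v *)
(** For a test function [F] on [X * U] let [push F x] be the integral of
    [F (x, v) v^k] over [v], a test function on [X] with values in Sym^k(V).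
    Since [G] preserves the Haar measure, [push] is equivariant; it is also
    continuous, so [xi \o push] is an equivariant distribution on [X * U] and
    vanishes. It remains to see that [push] is onto. Let [b >= 0] be a bump
    function in [U] and let [c_i] be the coordinates of [v^k]. The Gram matrix of
    the integrals of [b c_i c_j] is invertible, because by polarization a linear
    form that kills [v^k] for all [v] in a nonempty open set is zero. Hence there
    are [phi_i] supported in [U] such that the integral of [phi_i c_j] is 1 if
    [i = j] and 0 otherwise, and [f] with coordinates [f_i] is the image of the sum
    of the [phi_i (v) f_i (x)]. *)

Require Import Defs.
From HB Require Import structures.
From mathcomp Require Import all_boot all_order all_algebra.
From mathcomp Require Import all_classical all_reals all_analysis.
From mathcomp.real_closed Require Import complex.
From mathcomp Require Import -(notations) mpoly.
From mathcomp Require Import measurable_realfun.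
From mathcomp Require Import ring lra.
Import Order.TTheory GRing.Theory Num.Theory.
Import numFieldNormedType.Exports.
Local Open Scope classical_set_scope.
Local Open Scope ring_scope.
Local Open Scope complex_scope.

Set Implicit Arguments.
Unset Strict Implicit.
Unset Printing Implicit Defensive.

(** * Smooth functions on open sets *)

(** The right inverse of [push] built from bump functions is not equivariant; only surjectivity is
    asked of it, and the equivariance is carried by [push] alone. That equivariance is exact because
    v -> v^k intertwines the actions on V and Sym^k(V) and the change of variables by g has factor
    1. The bulk of the work is analytic. Smoothness is the existence and continuity of all iterated
    directional derivatives, so the basic smoothness claims exhibit a class of functions closed
    under differentiation; fiber integrals form such a class once derivatives along X pass under the
    integral sign. The same formula bounds the derivatives of [push F] by those of [F] over a
    compact set, which gives continuity for the inductive limit topology. Integrals are real, so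
    complex values are split by Im z = Re (- i z). *)

Section SmoothCalculus.
Context {R : realType}.
Local Notation smooth := (@smooth_on R _ R^o).

Lemma open_near_eq (T : topologicalType) (S : Type) (O : set T) (f g : T -> S) x :
  open O -> {in O, f =1 g} -> O x -> \forall y \near x, f y = g y.
Proof.
move=> oO fg Ox; apply: filterS (open_nbhs_nbhs (conj oO Ox)) => y Oy.
by apply: fg; rewrite inE.
Qed.

Lemma near_eq_cvg_for (T S : topologicalType) (f g : T -> S) x :
  (\forall y \near x, f y = g y) -> {for x, continuous f} -> {for x, continuous g}.
Proof.
move=> fg cf; rewrite /prop_for/continuous_at -(nbhs_singleton fg).
exact: cvg_trans (near_eq_cvg fg) cf.
Qed.

(* A coinduction principle: a class of functions that are continuous and
   differentiable with derivatives in the class consists of smooth functions. *)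
Lemma smooth_coind n (O : set 'cV[R]_n) (P : ('cV[R]_n -> R^o) -> Prop) :
  open O ->
  (forall f x, P f -> O x -> {for x, continuous f}) ->
  (forall f v, P f -> exists2 g, P g &
     forall x, O x -> is_derive x v f (g x)) ->
  forall f, P f -> smooth O f.
Proof.
move=> oO Pc Pd f Pf vs v x Ox.
have [g Pg fg] : exists2 g, P g & {in O, dirD vs f =1 g}.
  elim: vs => [|w vs [g Pg fg]]; first by exists f.
  have [h Ph gh] := Pd g w Pg; exists h => // y; rewrite inE => Oy /=.
  have := open_near_eq oO fg Oy => /near_eq_derive ->.
  by have [_ ->] := gh y Oy.
have gf : \forall y \near x, g y = dirD vs f y.
  by apply: open_near_eq oO _ Ox => y Oy; rewrite fg.
split; last exact: near_eq_cvg_for gf (Pc _ _ Pg Ox).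
have [h Ph gh] := Pd g v Pg.
by apply: near_eq_derivable gf _; have [] := gh x Ox.
Qed.

Lemma smooth_cont n (O : set 'cV[R]_n) (f : 'cV[R]_n -> R^o) x :
  smooth O f -> O x -> {for x, continuous f}.
Proof. by move=> sf Ox; have [] := sf [::] 0 x Ox. Qed.

Lemma smooth_is_derive n (O : set 'cV[R]_n) (f : 'cV[R]_n -> R^o) v x :
  smooth O f -> O x -> is_derive x v f ('D_v f x).
Proof. by move=> sf Ox; apply: derivableP; have [] := sf [::] v x Ox. Qed.

Lemma smooth_derive n (O : set 'cV[R]_n) (f : 'cV[R]_n -> R^o) v :
  smooth O f -> smooth O ('D_v f).
Proof.
move=> sf vs; have -> : dirD vs ('D_v f) = dirD (rcons vs v) f; last exact: sf.
by rewrite /dirD foldr_rcons.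
Qed.

Lemma dirD_eq n (O : set 'cV[R]_n) (f g : 'cV[R]_n -> R^o) vs : open O ->
  {in O, f =1 g} -> {in O, dirD vs f =1 dirD vs g}.
Proof.
move=> oO fg; elim: vs => [|v vs IH] //= x; rewrite inE => Ox.
by apply: near_eq_derive; exact: open_near_eq oO IH Ox.
Qed.

Lemma smooth_eq n (O : set 'cV[R]_n) (f g : 'cV[R]_n -> R^o) : open O ->
  {in O, f =1 g} -> smooth O f -> smooth O g.
Proof.
move=> oO fg sf vs v x Ox; have [d c] := sf vs v x Ox.
have := open_near_eq oO (dirD_eq vs oO fg) Ox.
by move=> e; split; [exact: near_eq_derivable e d|exact: near_eq_cvg_for e c].
Qed.

(** Products alone are not closed under differentiation, because the Leibniz rule yields sums of
    products; the generated algebra is closed, so [smooth_coind] gives sums and products at once. *)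
Inductive alg_gen n (O : set 'cV[R]_n) : ('cV[R]_n -> R^o) -> Prop :=
| ag_base f : smooth O f -> alg_gen O f
| ag_add f g : alg_gen O f -> alg_gen O g -> alg_gen O (f + g)
| ag_mul f g : alg_gen O f -> alg_gen O g ->
    alg_gen O ((f : _ -> R) * (g : _ -> R)).

Lemma alg_gen_smooth n (O : set 'cV[R]_n) f : open O -> alg_gen O f -> smooth O f.
Proof.
move=> oO; apply: smooth_coind => // [g x|g v].
  elim=> [h sh Ox|h k _ IH _ IH' Ox|h k _ IH _ IH' Ox]; first exact: smooth_cont sh Ox.
    by apply: (@continuousD _ R^o); [exact: IH|exact: IH'].
  by apply: continuousM; [exact: IH|exact: IH'].
elim=> [h sh|h k Ph [h' Ph' hh'] Pk [k' Pk' kk']|h k Ph [h' Ph' hh'] Pk [k' Pk' kk']].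
- by exists ('D_v h); [apply/ag_base/smooth_derive|move=> x /(smooth_is_derive v sh)].
- exists (h' + k'); first exact: ag_add.
  by move=> x Ox; apply: is_deriveD; [exact: hh'|exact: kk'].
- exists ((h : _ -> R) * (k' : _ -> R) + (k : _ -> R) * (h' : _ -> R)).
    by apply: ag_add; apply: ag_mul.
  move=> x Ox; apply: is_derive_eq; first by apply: is_deriveM; [exact: hh'|exact: kk'].
  by [].
Qed.

Lemma smoothD n (O : set 'cV[R]_n) (f g : 'cV[R]_n -> R^o) : open O ->
  smooth O f -> smooth O g -> smooth O (fun x => f x + g x).
Proof. by move=> oO sf sg; apply/(alg_gen_smooth oO)/ag_add; apply: ag_base. Qed.

Lemma smoothM n (O : set 'cV[R]_n) (f g : 'cV[R]_n -> R^o) : open O ->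
  smooth O f -> smooth O g -> smooth O (fun x => (f x : R) * (g x : R)).
Proof. by move=> oO sf sg; apply/(alg_gen_smooth oO)/ag_mul; apply: ag_base. Qed.

Lemma smooth_cst n (O : set 'cV[R]_n) (c : R) : open O -> smooth O (fun=> c).
Proof.
move=> oO; apply: (@smooth_coind _ _ (fun f => exists c : R, f = cst c)) => //.
- by move=> f x [b ->] _; exact: cst_continuous.
- by move=> f v [b ->]; exists (cst 0); [exists 0|move=> x _; exact: is_derive_cst].
- by exists c.
Qed.

Lemma smoothZ n (O : set 'cV[R]_n) (c : R) (f : 'cV[R]_n -> R^o) : open O ->
  smooth O f -> smooth O (fun x => c * (f x : R)).
Proof. by move=> oO; apply: smoothM => //; exact: smooth_cst. Qed.

Lemma smooth_sum n (O : set 'cV[R]_n) (I : Type) (r : seq I) (P : pred I)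
    (F : I -> 'cV[R]_n -> R^o) : open O ->
  (forall i, P i -> smooth O (F i)) -> smooth O (fun x => \sum_(i <- r | P i) F i x).
Proof.
move=> oO sF; elim: r => [|i r IH].
  by apply: smooth_eq (smooth_cst 0 oO) => // x _; rewrite big_nil.
case Pi: (P i).
  by apply: smooth_eq (smoothD oO (sF i Pi) IH) => // x _; rewrite big_cons Pi.
by apply: smooth_eq IH => // x _; rewrite big_cons Pi.
Qed.

Lemma smooth_prod n (O : set 'cV[R]_n) (I : Type) (r : seq I)
    (F : I -> 'cV[R]_n -> R^o) : open O ->
  (forall i, smooth O (F i)) -> smooth O (fun x => \prod_(i <- r) (F i x : R)).
Proof.
move=> oO sF; elim: r => [|i r IH].
  by apply: smooth_eq (smooth_cst 1 oO) => // x _; rewrite big_nil.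
by apply: smooth_eq (smoothM oO (sF i) IH) => // x _; rewrite big_cons.
Qed.

Lemma continuous_mxP (T : topologicalType) p q (f : T -> 'M[R]_(p, q)) x :
  (forall i j, {for x, continuous (fun y => f y i j : R^o)}) -> {for x, continuous f}.
Proof.
move=> cf; apply/cvgrPdist_le => /= e e0; near=> y.
rewrite /Num.Def.normr/= mx_normrE (bigmax_le _ (ltW e0))//= => i _.
rewrite !mxE/=; move: i; near: y; apply: filter_forall => /= i.
by have /cvgrPdist_le := cf i.1 i.2; apply.
Unshelve. all: by end_near. Qed.

Lemma continuous_mulmxl p q (L : 'M[R]_(p, q)) :
  continuous (fun x : 'cV[R]_q => (L *m x : 'cV[R]_p)).
Proof.
move=> x; apply: continuous_mxP => i j.
have -> : (fun y : 'cV[R]_q => (L *m y) i j : R^o) =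
    \sum_k (fun y : 'cV[R]_q => L i k * y k j : R^o).
  by apply/funext => y; rewrite mxE fct_sumE.
elim/big_ind: _ => [|f g cf cg|k _]; first exact: cst_continuous.
  exact: (@continuousD _ R^o).
apply: continuousM; first exact: cst_continuous.
exact: (@coord_continuous R q 1 k j).
Unshelve. all: by end_near. Qed.

(** The class of all g (L x) with g smooth is closed under differentiation, because the difference
    quotient of g (L x) along v is that of g along L v. It serves to compose with the projections of
    a product chart. *)
Lemma smooth_mulmx p q (L : 'M[R]_(p, q)) (O : set 'cV[R]_p)
    (f : 'cV[R]_p -> R^o) : open O -> smooth O f ->
  smooth [set x : 'cV[R]_q | O (L *m x)] (fun x : 'cV[R]_q => f (L *m x)).
Proof.
move=> oO sf.
have cL : continuous (fun x : 'cV[R]_q => L *m x) by exact: continuous_mulmxl.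
apply: (@smooth_coind _ _ (fun h => exists2 g, smooth O g & h = (fun x => g (L *m x)))).
- by move/continuousP: cL => /(_ _ oO).
- move=> _ x [g sg ->] Ox; apply: (@continuous_comp _ _ _ (fun x => L *m x)); first exact: cL.
  exact: smooth_cont sg Ox.
- move=> _ v [g sg ->]; exists (fun x => 'D_(L *m v) g (L *m x)).
    by exists ('D_(L *m v) g) => //; exact: smooth_derive.
  move=> x Ox; have [] := smooth_is_derive (L *m v) sg Ox.
  have E : (fun h : R => h^-1 *: (((fun x => g (L *m x)) \o shift x) (h *: v) - g (L *m x)))
    = (fun h : R => h^-1 *: ((g \o shift (L *m x)) (h *: (L *m v)) - g (L *m x))).
    by apply/funext => h /=; rewrite mulmxDr -scalemxAr.
  by rewrite /derivable /derive => c e; split; rewrite /derivable /derive E.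
- by exists f.
Qed.

Lemma smooth_sub n (O O' : set 'cV[R]_n) (f : 'cV[R]_n -> R^o) :
  O' `<=` O -> smooth O f -> smooth O' f.
Proof. by move=> OO sf vs v x /OO; exact: sf. Qed.

Lemma smooth_coord n (O : set 'cV[R]_n) i : open O ->
  smooth O (fun x => x i 0 : R^o).
Proof.
move=> oO; apply: (@smooth_coind _ _
  (fun f => exists (a b : R), f = (fun x => a * x i 0 + b))) => //.
- move=> _ x [a [b ->]] _; apply: (@continuousD _ R^o); last exact: cst_continuous.
  apply: continuousM; first exact: cst_continuous.
  exact: (@coord_continuous R n 1 i 0).
- move=> _ v [a [b ->]]; exists (fun=> a * v i 0).
    by exists 0, (a * v i 0); apply/funext => x; rewrite mul0r add0r.
  move=> x Ox.
  have E : {near (0 : R)^', (fun h : R => h^-1 *: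
     (((fun y : 'cV[R]_n => a * y i 0 + b) \o shift x) (h *: v)
        - (a * x i 0 + b) : R^o)) =1 (fun=> a * v i 0)}.
    near=> h => /=; rewrite !mxE.
    have h0 : h != 0 by near: h; exact: nbhs_dnbhs_neq.
    by rewrite opprD addrACA subrr addr0 -mulrBr addrK mulrCA /GRing.scale/= mulKf.
  have c : (fun h : R => h^-1 *:
     (((fun y : 'cV[R]_n => a * y i 0 + b) \o shift x) (h *: v)
        - (a * x i 0 + b) : R^o)) @ 0^' --> (a * v i 0 : R^o).
    by apply: cvg_trans (near_eq_cvg _) (cvg_cst _); near=> h; rewrite -(near E h).
  by apply: DeriveDef; [apply/cvg_ex; eexists; exact: c|exact: cvg_lim c].
- by exists 1, 0; apply/funext => x; rewrite mul1r addr0.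
Unshelve. all: by end_near. Qed.

Lemma smooth_continuous n (f : 'cV[R]_n -> R^o) : smooth setT f -> continuous f.
Proof. by move=> sf x; exact: smooth_cont sf _. Qed.

Lemma dirDD q (O : set 'cV[R]_q) (f g : 'cV[R]_q -> R^o) vs y : open O ->
  smooth_on O f -> smooth_on O g -> O y ->
  dirD vs (fun x => f x + g x) y = dirD vs f y + dirD vs g y.
Proof.
move=> oO sf sg; elim: vs y => [//|v vs IH] y Oy /=.
have E : {in O, dirD vs (fun x => f x + g x) =1 (dirD vs f + dirD vs g)}.
  by move=> x; rewrite inE; exact: IH.
rewrite (near_eq_derive _ (open_near_eq oO E Oy)) deriveD//.
  by have [] := sf vs v y Oy.
by have [] := sg vs v y Oy.
Qed.

End SmoothCalculus.

(** * Bump functions *)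

Section Bump.
Context {R : realType}.

(** Reduces directional derivatives to one real variable, where the chain rule is at hand. *)
Lemma is_derive_line n (W : normedModType R) (f : 'cV[R]_n -> W) (x v : 'cV[R]_n) df :
  is_derive (0 : R) (1 : R) (fun h : R => f (h *: v + x)) df -> is_derive x v f df.
Proof.
case=> d e; have d' := (derivable1P f x v).2 d.
apply: DeriveDef => //.
rewrite -e /derive.
set F := (fun h => h^-1 *: _); set G := (fun h => h^-1 *: _).
suff -> : F = G by [].
by apply/funext => h; rewrite /F /G /= scale0r add0r addr0 [_%:A]mulr1.
Qed.

(** The exponential series gives s^N exp(-s) <= N!, here with N two more than the size of q: the
    size absorbs the growth of q, and the two spare powers give the quadratic flatness used for
    differentiability at 0. *)
Lemma horner_expRN_bound (q : {poly R}) : exists2 C : R, 0 <= C &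
  forall s, 1 <= s -> `|q.[s] * expR (- s)| <= C / s ^+ 2.
Proof.
pose d := (size q).+1.
exists ((\sum_(i < size q) `|q`_i|) * (d.+1)`!%:R).
  by rewrite mulr_ge0 ?ler0n// sumr_ge0.
move=> s s1; have s0 : 0 < s by rewrite (lt_le_trans ltr01).
have h1 : `|q.[s]| <= (\sum_(i < size q) `|q`_i|) * s ^+ size q.
  rewrite horner_coef (le_trans (ler_norm_sum _ _ _))// mulr_suml ler_sum// => i _.
  rewrite normrM ler_wpM2l// ger0_norm ?exprn_ge0 ?(ltW s0)//.
  by rewrite ler_weXn2l// ltnW.
have h2 : s ^+ d.+1 * expR (- s) <= (d.+1)`!%:R.
  rewrite expRN ler_pdivrMr ?expR_gt0//.
  have := expR_ge1Dxn d (ltW s0); rewrite -ler_pdivrMl ?ltr0n ?fact_gt0//.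
  by apply: le_trans; rewrite mulrC lerDr.
rewrite normrM (ger0_norm (expR_ge0 _)) ler_pdivlMr ?exprn_gt0//.
have -> : `|q.[s]| * expR (- s) * s ^+ 2 = `|q.[s]| * (s ^+ 2 * expR (- s)) by ring.
apply: le_trans (ler_wpM2r _ h1) _; first by rewrite mulr_ge0 ?exprn_ge0 ?expR_ge0// ltW.
rewrite -mulrA ler_wpM2l ?sumr_ge0//.
by rewrite mulrA -exprD addn2.
Qed.

(* [q(1/t) exp(-1/t)], extended by 0: a class closed under differentiation. *)
Definition flat (q : {poly R}) (t : R) : R :=
  if 0 < t then q.[t^-1] * expR (- t^-1) else 0.

(** With s = 1/t one has d/dt = - s^2 d/ds, so q(s) exp(-s) has t-derivative s^2 (q - q')(s)
    exp(-s). *)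
Definition flat_deriv (q : {poly R}) : {poly R} := 'X^2 * (q - q^`()).

Lemma flat_le q : exists2 C : R, 0 <= C & forall t, t <= 1 -> `|flat q t| <= C * t ^+ 2.
Proof.
have [C C0 HC] := horner_expRN_bound q; exists C => // t t1; rewrite /flat.
case: ifPn => [t0|_]; last by rewrite normr0 mulr_ge0 ?sqr_ge0.
have := HC t^-1; rewrite invf_ge1// => /(_ t1).
by rewrite exprVn invrK.
Qed.

(** Away from 0 this is calculus; at 0 the bound C t^2 of [flat_le] makes the difference quotient at
    most C |h|. *)
Lemma flat_is_derive q (x : R) : is_derive x (1 : R) (flat q) (flat (flat_deriv q) x).
Proof.
have [x0|x0|->] := ltgtP x 0.
- have -> : flat (flat_deriv q) x = 0 by rewrite /flat ltNge ltW.
  apply: (@near_eq_is_derive _ _ _ (cst (0 : R))).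
  near=> t; have t0 : t < 0 by near: t; exact: lt_nbhsl.
  by rewrite /flat ltNge (ltW t0).
- have xn0 : x != 0 by rewrite gt_eqF.
  have dV : is_derive x (1 : R) (fun t : R => t^-1) (- x ^- 2).
    by apply: is_derive_eq; first exact: is_deriveV; rewrite ?scaler1 ?mulr1.
  have d1 := @is_derive1_comp _ (horner q) _ x _ _ (is_derive_poly _ _) dV.
  have d2 := @is_derive1_comp _ expR _ x _ _ (is_derive_expR _) (is_deriveN dV).
  have d3 : is_derive x (1 : R) (fun t => q.[t^-1] * expR (- t^-1)) (flat (flat_deriv q) x).
    apply: (is_derive_eq (is_deriveM d1 d2)).
    rewrite /flat x0 /flat_deriv !hornerE /= /GRing.scale/= exprVn /=.
    by field.
  apply: near_eq_is_derive d3.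
  near=> t; have t0 : 0 < t by near: t; exact: lt_nbhsr.
  by rewrite /flat t0.
- have -> : flat (flat_deriv q) 0 = 0 by rewrite /flat ltxx.
  have [C C0 HC] := flat_le q.
  have f0 : flat q 0 = 0 by rewrite /flat ltxx.
  have c : (fun h : R => h^-1 *: ((flat q \o shift 0) (h *: (1 : R)) - flat q 0)) @ 0^'
     --> (0 : R).
    apply/cvgrPdist_le => e e0; near=> h; rewrite sub0r normrN /= f0 subr0 addr0.
    rewrite [_%:A]mulr1 /GRing.scale /= normrM normfV.
    have h0 : h != 0 by near: h; exact: nbhs_dnbhs_neq.
    have h1 : `|h| <= 1 by near: h; apply: dnbhs0_le.
    have he : `|h| <= e / (C + 1) by near: h; apply: dnbhs0_le; rewrite divr_gt0// ltr_wpDl.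
    rewrite ler_pdivrMl ?normr_gt0//.
    apply: le_trans (HC h (le_trans (ler_norm _) h1)) _.
    rewrite -(real_normK (num_real h)) expr2 mulrCA ler_wpM2l//.
    move: he; rewrite ler_pdivlMr ?ltr_wpDl// => he.
    by apply: le_trans he; rewrite mulrC ler_wpM2l// lerDl.
  by split; [apply/cvg_ex; eexists; exact: c|exact: cvg_lim c].
Unshelve. all: by end_near. Qed.

(** The closed class consists of all c flat q (a x_i + b) with a and b fixed: a derivative along v
    multiplies c by a v_i and replaces q by [flat_deriv q]. *)
Lemma flat_coord_smooth n (i : 'I_n) (a b : R) q :
  @smooth_on R n R^o setT (fun x => flat q (a * x i 0 + b)).
Proof.
apply: (@smooth_coind _ _ _ (fun f => exists (c : R) q, f = fun x => c * flat q (a * x i 0 + b))).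
- exact: openT.
- move=> _ x [c [p ->]] _; apply: continuousM; first exact: cst_continuous.
  apply: (@continuous_comp _ _ _ (fun x : 'cV[R]_n => a * x i 0 + b)).
    apply: (@continuousD _ R^o); last exact: cst_continuous.
    apply: continuousM; first exact: cst_continuous.
    exact: (@coord_continuous R n 1 i 0).
  by have [d _] := flat_is_derive p (a * x i 0 + b); exact/differentiable_continuous/derivable1_diffP.
- move=> _ v [c [p ->]].
  exists (fun x => (c * (a * v i 0)) * flat (flat_deriv p) (a * x i 0 + b)); first by do 2 eexists.
  move=> x _; apply: is_derive_line.
  have -> : (fun h : R => c * flat p (a * (h *: v + x) i 0 + b) : R^o) =
     c \*: (flat p \o (fun h : R => (a * v i 0) * h + (a * x i 0 + b))).
    apply/funext => h /=; rewrite !mxE; congr (_ * flat _ _); ring.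
  have dl : is_derive (0 : R) (1 : R) (fun h : R => (a * v i 0) * h + (a * x i 0 + b)) (a * v i 0).
    apply: (is_derive_eq (is_deriveD
      (is_deriveZ (a * v i 0) (is_derive_id (0 : R) (1 : R)))
      (is_derive_cst (a * x i 0 + b : R) (0 : R) (1 : R)))).
    by rewrite addr0 [_%:A]mulr1.
  have df := flat_is_derive p (a * x i 0 + b).
  rewrite -[X in is_derive X](add0r (a * x i 0 + b)) -{1}(mulr0 (a * v i 0)) in df.
  apply: (is_derive_eq (is_deriveZ c (@is_derive1_comp _ (flat p) _ 0 _ _ df dl))).
  rewrite /GRing.scale /=; ring.
- by exists 1, q; apply/funext => x; rewrite mul1r.
Qed.

Lemma compact_cbox n (u : 'cV[R]_n) r :
  compact [set x : 'cV[R]_n | forall i, `|x i 0 - u i 0| <= r].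
Proof.
pose B := [set y : 'rV[R]_n | forall i, `[u i 0 - r, u i 0 + r]%classic (y 0 i)].
have cB : compact B.
  by apply: (@rV_compact _ _ (fun i => `[u i 0 - r, u i 0 + r]%classic)) => i; exact: segment_compact.
have -> : [set x : 'cV[R]_n | forall i, `|x i 0 - u i 0| <= r] = trmx @` B.
  apply/seteqP; split => [x xr|_ [y yB <-] i].
    exists x^T; last by rewrite trmxK.
    by move=> i; rewrite /= mxE in_itv /= -ler_distl.
  by have := yB i; rewrite /= !mxE in_itv /= -ler_distl.
apply: continuous_compact => //; apply: continuous_subspaceT => y.
apply: continuous_mxP => i j.
rewrite (_ : (fun _ => _) = fun z : 'rV[R]_n => z j i : R^o); last by apply/funext => z; rewrite mxE.
exact: (@coord_continuous R 1 n j i).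
Qed.

Lemma bump_exists n (U : set 'cV[R]_n) u : open U -> U u ->
  exists b : 'cV[R]_n -> R^o, [/\ @smooth_on R n R^o setT b, forall x, 0 <= b x, 0 < b u &
    exists K, [/\ compact K, K `<=` U & forall x, ~ K x -> b x = 0]].
Proof.
move=> oU Uu; have /nbhs_ballP[r /= r0 rU] := open_nbhs_nbhs (conj oU Uu).
(* The norm is the sup norm; halving r keeps the closed cube of radius e inside the open ball. *)
pose e := r / 2; have e0 : 0 < e by rewrite divr_gt0.
have flat1 t : 0 <= flat 1 t.
  by rewrite /flat; case: ifP => // _; rewrite hornerC mul1r expR_ge0.
have flat1_gt0 t : 0 < t -> 0 < flat 1 t.
  by move=> t0; rewrite /flat t0 hornerC mul1r expR_gt0.
(* The factor of coordinate i is positive exactly when |x_i - u_i| < e, because [flat 1] is positive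
   exactly on the positive reals. *)
pose b (x : 'cV[R]_n) : R := \prod_(i < n)
   (flat 1 (1 * x i 0 + (e - u i 0)) * flat 1 (-1 * x i 0 + (e + u i 0))).
exists b; split.
- apply: smooth_prod; first exact: openT.
  by move=> i; apply: smoothM; [exact: openT|exact: flat_coord_smooth..].
- by move=> x; apply: prodr_ge0 => i _; rewrite mulr_ge0.
- rewrite /b; apply: prodr_gt0 => i _.
  by rewrite mulr_gt0// flat1_gt0// ?mul1r ?mulN1r addrC ?subrK ?addrK.
exists [set x : 'cV[R]_n | forall i, `|x i 0 - u i 0| <= e]; split.
- exact: compact_cbox.
- move=> x /= xe; apply: rU; rewrite -ball_normE /ball_/= /Num.Def.normr/= mx_normrE.
  apply: bigmax_lt => // -[i j] _; rewrite !mxE ord1 distrC.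
  by rewrite (le_lt_trans (xe i))// /e ltr_pdivrMr// ltr_pMr// ltr1n.
- move=> x /existsNP[i /negP]; rewrite -ltNge => xi.
  rewrite /b (bigD1 i)//= /flat mul1r mulN1r.
  case: ifPn => [h1|]; last by rewrite !mul0r.
  case: ifPn => [h2|]; last by rewrite mulr0 mul0r.
  suff : `|x i 0 - u i 0| < e by rewrite ltNge (ltW xi).
  by rewrite ltr_norml; apply/andP; split; lra.
Qed.

End Bump.

(** * Integration against Haar measure *)

Section HaarIntegral.
Context {R : realType} {m : nat}.
Local Notation V := 'cV[R]_m.

Definition supported (K : set V) (h : V -> R) : Prop :=
  [/\ compact K, continuous h & forall x, ~ K x -> h x = 0].

Lemma measurable_open (O : set V) : open O -> measurable (O : set (borelV R m)).
Proof. by move=> oO; exact: sub_sigma_algebra. Qed.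

Lemma measurable_closed (F : set V) : closed F -> measurable (F : set (borelV R m)).
Proof. by move=> cF; rewrite -(setCK F); apply: measurableC; apply: measurable_open; exact: closed_openC. Qed.

Lemma measurable_compact (K : set V) : compact K -> measurable (K : set (borelV R m)).
Proof.
by move=> cK; apply: measurable_closed; apply: compact_closed => //; exact: norm_hausdorff.
Qed.

Lemma measurable_cont (h : V -> R) : continuous h -> measurable_fun setT (h : borelV R m -> R).
Proof.
move=> /continuousP ch; apply: (measurability _ (RGenOpens.measurableE R)).
move=> _ [_ [a [b ->]] <-]; rewrite setTI; apply: measurable_open.
exact/ch/interval_open.
Qed.

Lemma measurable_contV (h : V -> V) : continuous h ->
  measurable_fun setT (h : borelV R m -> borelV R m).
Proof.
move=> /continuousP ch; apply: (@measurability _ _ (borelV R m) (borelV R m) setT h (@open V)) => //.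
by move=> _ [B oB <-]; rewrite setTI; apply: measurable_open; exact: ch.
Qed.

Lemma supported_bounded K h : supported K h ->
  exists2 M : R, 0 <= M & forall x, `|h x| <= M.
Proof.
case=> cK ch h0.
have : compact (h @` K) by apply: continuous_compact => //; exact: continuous_subspaceT.
move=> /compact_bounded [M [Mr hM]]; exists (`|M| + 1); first by rewrite addr_ge0.
move=> x; have [Kx|nKx] := pselect (K x); last by rewrite h0// normr0 addr_ge0.
by apply: hM; [rewrite (le_lt_trans (ler_norm _))// ltrDl|exists x].
Qed.

Lemma supportedD K h1 h2 (c : R) : supported K h1 -> supported K h2 ->
  supported K (fun x => c * h1 x + h2 x).
Proof.
move=> [cK c1 z1] [_ c2 z2]; split=> //.
  move=> x; have c1' : {for x, continuous (fun y => c * h1 y)}.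
    by apply: continuousM; [exact: cst_continuous|exact: c1].
  exact: (@continuousD _ R _ _ h2 x c1' (c2 x)).
by move=> x nK; rewrite z1// z2// mulr0 addr0.
Qed.

Lemma supportedM K h1 h2 : supported K h1 -> continuous h2 ->
  supported K (fun x => h1 x * h2 x).
Proof.
move=> [cK c1 z1] c2; split=> //; last by move=> x nK; rewrite z1// mul0r.
by move=> x; apply: continuousM; [exact: c1|exact: c2].
Qed.

Lemma supported0 K : compact K -> supported K (fun=> 0).
Proof. by move=> cK; split=> // x; exact: cst_continuous. Qed.

Variable mu : {measure set (borelV R m) -> \bar R}.
Hypothesis hmu : is_haar mu.

Definition haar_int (h : V -> R) : R := Rintegral mu setT (h : borelV R m -> R).

Lemma supported_integrable K h : supported K h ->
  mu.-integrable setT (EFin \o (h : borelV R m -> R)).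
Proof.
move=> sh; have [M M0 hM] := supported_bounded sh; case: sh => cK ch h0.
have mK := measurable_compact cK.
have E : (EFin \o (h : borelV R m -> R)) \_ K = EFin \o h.
  apply/funext => x; rewrite patchE; case: ifPn => //= /negP nK.
  by rewrite h0// => Kx; apply: nK; rewrite inE.
rewrite -E; apply/(integrable_mkcond _ mK).
apply: measurable_bounded_integrable => //.
- by have [_ + _] := hmu; apply.
- by apply: measurable_funTS; exact: measurable_cont.
- by exists M; split; [exact: num_real|] => N MN x Kx /=; rewrite (le_trans (hM x))// ltW.
Qed.

Lemma haar_intD K h1 h2 c : supported K h1 -> supported K h2 ->
  haar_int (fun x => c * h1 x + h2 x) = c * haar_int h1 + haar_int h2.
Proof.
move=> s1 s2; rewrite /haar_int RintegralD//.
- by rewrite RintegralZl//; exact: supported_integrable s1.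
- apply: (@supported_integrable K (fun x => c * h1 x)).
  have := supportedD c s1 (supported0 _); case: s1 => cK _ _ /(_ cK).
  by under [X in supported K X]funext do rewrite addr0.
- exact: supported_integrable s2.
Qed.

Lemma haar_int0 : haar_int (fun=> 0) = 0.
Proof.
have := haar_intD (-1) (supported0 (@compact_set1 V 0)) (supported0 (@compact_set1 V 0)).
by rewrite mulr0 addr0 mulN1r addNr.
Qed.

Lemma haar_int_bound K h e : supported K h -> (forall x, K x -> `|h x| <= e) ->
  `|haar_int h| <= e * fine (mu K).
Proof.
move=> sh he; have ih := supported_integrable sh; case: sh => cK ch h0.
have mK := measurable_compact cK.
have E : haar_int h = Rintegral mu K (h : borelV R m -> R).
  rewrite /haar_int [RHS]Rintegral_mkcond; apply: eq_Rintegral => x _.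
  rewrite patchE; case: ifPn => //= /negP nK.
  by rewrite h0// => Kx; apply: nK; rewrite inE.
have iK : mu.-integrable K (EFin \o (h : borelV R m -> R)) by exact: integrableS ih.
rewrite E -Rintegral_cst//; apply: le_trans (le_normr_Rintegral mK iK) _.
apply: le_Rintegral => //; first exact: (@integrable_norm _ _ _ mu K (h : borelV R m -> R)).
apply: measurable_bounded_integrable => //; first by have [_ + _] := hmu; apply.
by exists `|e|; split; [exact: num_real|] => N eN x Kx /=; exact: ltW.
Qed.

Lemma haar_int_sum K (I : Type) (r : seq I) (c : I -> R) (h : I -> V -> R) :
  compact K -> (forall i, supported K (h i)) ->
  supported K (fun x => \sum_(i <- r) c i * h i x) /\
  haar_int (fun x => \sum_(i <- r) c i * h i x) = \sum_(i <- r) c i * haar_int (h i).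
Proof.
move=> cK sh; elim: r => [|i r [IHs IH]].
  under [X in supported K X]funext do rewrite big_nil.
  under [X in haar_int X]funext do rewrite big_nil.
  by rewrite big_nil haar_int0; split; first exact: supported0.
under [X in supported K X]funext do rewrite big_cons.
under [X in haar_int X]funext do rewrite big_cons.
rewrite big_cons -IH; split; first exact: supportedD.
exact: haar_intD.
Qed.

(** The image of mu under A gives E the mass of its preimage, which is B E, so this image is mu
    itself; the claim is then the integral formula for image measures. *)
Lemma haar_int_invariant (A B : 'M[R]_m) K h : A *m B = 1%:M -> B *m A = 1%:M ->
  (forall E : set (borelV R m), measurable E ->
     mu [set (B *m w : V) | w in (E : set V)] = mu E) ->
  supported K h -> supported [set x | K (A *m x)] (fun x => h (A *m x)) ->
  haar_int (fun x => h (A *m x)) = haar_int h.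
Proof.
move=> AB BA inv sh sh'.
pose phi : borelV R m -> borelV R m := fun x : V => A *m x : V.
have mphi : measurable_fun setT phi by apply: measurable_contV; exact: continuous_mulmxl.
pose hE : borelV R m -> \bar R := fun x => (h x)%:E.
have mh : measurable_fun setT hE.
  by apply/measurable_EFinP; apply: measurable_cont; case: sh.
rewrite /haar_int /Rintegral; congr fine.
have := @integral_pushforward _ _ (borelV R m) (borelV R m) R phi mphi mu setT _ mh.
rewrite preimage_setT => /(_ (supported_integrable sh') measurableT) <-.
apply: eq_measure_integral => E mE _; apply: (etrans _ (inv _ mE)).
rewrite /pushforward; congr (mu _).
apply/seteqP; split => [x Ex|_ [w Ew <-]].
  by exists (A *m x) => //; rewrite mulmxA BA mul1mx.
by rewrite /phi /preimage /= mulmxA AB mul1mx.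
Qed.

(* The rational translates of a nonempty open set cover the space. *)
Lemma haar_open_neq0 (O : set V) v0 : open O -> O v0 -> mu O != 0%E.
Proof.
move=> oO Ov0; apply/eqP => O0.
have [inv _ /eqP] := hmu; apply.
pose tr (q : 'cV[rat]_m) : set (borelV R m) :=
  [set (map_mx ratr q + w : V) | w in (O : set V)].
have tr_open q : open (tr q : set V).
  have -> : tr q = (fun x : V => x - map_mx ratr q) @^-1` O.
    apply/seteqP; split => [_ [w Ow <-]|x Ox]; first by rewrite /preimage /= addrC addKr.
    by exists (x - map_mx ratr q) => //; rewrite addrC subrK.
  have /continuousP : continuous (fun x : V => x - map_mx ratr q).
    by move=> x; apply: (@continuousB _ V _ id (cst (map_mx ratr q))); [exact: cvg_id|exact: cst_continuous].
  exact.
pose F (n : nat) := if @unpickle ('cV[rat]_m) n is Some q then tr q else set0.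
have nF k : mu.-negligible (F k).
  rewrite /F; case: unpickle => [q|]; last exact: negligible_set0.
  apply/negligibleP; first exact: (measurable_open (tr_open q)).
  exact: (etrans (inv (map_mx ratr q) _ (measurable_open oO)) O0).
apply: (measure_negligible measurableT); rewrite (_ : setT = \bigcup_k F k); first exact: negligible_bigcup.
apply/esym; rewrite -subTset => x _.
have /nbhs_ballP[r /= r0 rO] := open_nbhs_nbhs (conj oO Ov0).
(* Approximating x - v0 coordinatewise by a rational vector q within r puts x - q in the ball around
   v0, so x lies in the translate of O by q. *)
have /choice[q hq] : forall i : 'I_m, exists q : rat, `|x i 0 - v0 i 0 - ratr q| < r.
  move=> i; have [|q] := @rat_in_itvoo R (x i 0 - v0 i 0 - r) (x i 0 - v0 i 0 + r).
    by rewrite ltrD2l gtrN.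
  rewrite in_itv => /andP[h1 h2]; exists q.
  have h1' : x i 0 - v0 i 0 - r < ratr q := h1.
  have h2' : ratr q < x i 0 - v0 i 0 + r := h2.
  by rewrite ltr_norml; apply/andP; clear h1 h2; split; lra.
exists (pickle (\col_i q i)) => //; rewrite /F pickleK.
exists (x - map_mx ratr (\col_i q i)); last by rewrite addrC subrK.
apply: rO; rewrite -ball_normE /ball_/= /Num.Def.normr/= mx_normrE.
apply: bigmax_lt => // -[i j] _; rewrite !mxE ord1 distrC.
by rewrite addrAC hq.
Qed.

(** On the open set where h exceeds half its value at v0, the integral is at least that half times
    the mass, which is positive by [haar_open_neq0]. *)
Lemma haar_int_gt0 K h v0 : supported K h -> (forall x, 0 <= h x) -> 0 < h v0 ->
  0 < haar_int h.
Proof.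
move=> sh h0 hv; have ih := supported_integrable sh; case: sh => cK ch hK.
have ifin := integrable_fin_num measurableT ih.
rewrite /haar_int /Rintegral -lte_fin fineK//.
pose c := h v0 / 2; have c0 : 0 < c by rewrite divr_gt0.
pose O : set (borelV R m) := [set x : V | c < h x].
have oO : open (O : set V).
  by have /continuousP/(_ [set y | c < y]) := ch; apply; exact: open_gt.
have mO : measurable O by exact: measurable_open.
pose hE : borelV R m -> \bar R := fun x => (h x)%:E.
have mh : measurable_fun setT hE.
  by apply/measurable_EFinP; exact: measurable_cont.
have le1 := @ge0_subset_integral _ _ _ mu O setT mO measurableT _ mh
  (fun x _ => h0 x : (0 <= (h x)%:E)%E) (@subsetT _ _).
apply: lt_le_trans le1.
have le2 : (\int[mu]_(x in O) cst c%:E x <= \int[mu]_(x in O) (EFin \o h) x)%E.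
  apply: ge0_le_integral => //.
  - by move=> x _; rewrite lee_fin ltW.
  - exact: measurable_funTS.
  - by move=> x Ox; rewrite lee_fin ltW.
apply: lt_le_trans le2; rewrite integral_cst// mule_gt0// ?lte_fin//.
rewrite lt0e measure_ge0 andbT; apply: (@haar_open_neq0 _ v0) => //.
by rewrite /O /= /c ltr_pdivrMr// ltr_pMr// ltr1n.
Qed.

End HaarIntegral.

(** * Differentiation under the integral sign *)

Section ParametricIntegral.
Context {R : realType} {n m : nat}.
Variable mu : {measure set (borelV R m) -> \bar R}.
Hypothesis hmu : is_haar mu.

Lemma continuous_dist (T : topologicalType) (f : T -> R^o) x :
  (forall e : R, 0 < e -> \forall y \near x, `|f y - f x| <= e) -> {for x, continuous f}.
Proof.
move=> h; apply/cvgrPdist_le => e e0.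
by apply: filterS (h e e0) => y; rewrite distrC.
Qed.

Lemma continuous_col_mx : continuous
  (fun p : 'cV[R]_m * 'cV[R]_n => (col_mx p.2 p.1 : 'cV[R]_(n + m))).
Proof.
move=> p; apply: continuous_mxP => i j; case: (fintype.split_ordP i) => k ->.
  rewrite (_ : (fun _ => _) = (fun q : 'cV[R]_m * 'cV[R]_n => q.2 k j : R^o)).
    by apply: (@continuous_comp _ _ _ snd (fun M : 'cV[R]_n => M k j : R^o));
      [exact: cvg_snd|exact: coord_continuous].
  by apply/funext => q; rewrite col_mxEu.
rewrite (_ : (fun _ => _) = (fun q : 'cV[R]_m * 'cV[R]_n => q.1 k j : R^o)).
  by apply: (@continuous_comp _ _ _ fst (fun M : 'cV[R]_m => M k j : R^o));
    [exact: cvg_fst|exact: coord_continuous].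
by apply/funext => q; rewrite col_mxEd.
Qed.

Lemma continuous_col_mxr (y : 'cV[R]_n) : continuous
  (fun v : 'cV[R]_m => (col_mx y v : 'cV[R]_(n + m))).
Proof.
move=> v; have := @continuous_comp _ _ _ (fun v : 'cV[R]_m => (v, y))
  (fun p : 'cV[R]_m * 'cV[R]_n => (col_mx p.2 p.1 : 'cV[R]_(n + m))) v.
apply; last exact: continuous_col_mx.
rewrite /prop_for /continuous_at.
apply: (@cvg_pair _ _ _ (nbhs v) (nbhs v) (nbhs y) _ _ _ (fun x => x) (fun=> y)).
  exact: cvg_id.
exact: cvg_cst.
Qed.

Lemma continuous_usubmx : continuous (fun z : 'cV[R]_(n + m) => usubmx z : 'cV[R]_n).
Proof.
move=> z; apply: continuous_mxP => i j.
rewrite (_ : (fun _ => _) = (fun z : 'cV[R]_(n + m) => z (lshift m i) j : R^o)).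
  exact: coord_continuous.
by apply/funext => y; rewrite mxE.
Qed.

(** The increment starts at 0 and t may have either sign, so the usual theorem is applied on [0, t]
    or on [t, 0]. *)
Lemma mean_value (f df : R -> R) d t : `|t| < d ->
  (forall s, `|s| < d -> is_derive s (1 : R) f (df s)) ->
  exists2 s, `|s| < d & f t - f 0 = df s * t.
Proof.
move=> td Df.
have cf s : `|s| < d -> {for s, continuous f}.
  by move=> /Df[+ _] => ?; exact/differentiable_continuous/derivable1_diffP.
have bnd a b s : `|a| < d -> `|b| < d -> a <= s <= b -> `|s| < d.
  move=> /ltr_normlP[a1 a2] /ltr_normlP[b1 b2] /andP[s1 s2].
  by rewrite ltr_norml; apply/andP; split; lra.
have d0 : `|0 : R| < d by rewrite normr0 (le_lt_trans (normr_ge0 t)).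
have mvt a b : a <= b -> `|a| < d -> `|b| < d ->
    exists2 s, `|s| < d & f b - f a = df s * (b - a).
  move=> ab ad bd; have [||s] := @MVT_segment R f df a b ab.
  - by move=> s; rewrite in_itv /= => /andP[/ltW s1 /ltW s2]; apply/Df/(bnd a b); rewrite ?s1.
  - apply: continuous_in_subspaceT => s; rewrite inE /= in_itv /= => sab.
    exact/cf/(bnd a b).
  by rewrite in_itv /= => /(bnd a b _ ad bd) sd E; exists s.
have [t0|/ltW t0] := leP 0 t.
  by have [s sd E] := mvt _ _ t0 d0 td; exists s => //; rewrite E subr0.
by have [s sd E] := mvt _ _ t0 td d0; exists s => //; rewrite -opprB E; ring.
Qed.

Lemma is_derive_along (k : nat) (f : 'cV[R]_k -> R^o) (w z : 'cV[R]_k) (s df : R) :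
  is_derive (s *: w + z) w f df ->
  is_derive s (1 : R) (fun h : R => f (h *: w + z) : R) df.
Proof.
case=> d e.
have E : (fun h : R => h^-1 *: (((fun h : R => f (h *: w + z) : R) \o shift s) (h *: (1 : R))
    - f (s *: w + z))) =
  (fun h : R => h^-1 *: ((f \o shift (s *: w + z)) (h *: w) - f (s *: w + z))).
  by apply/funext => h /=; rewrite [_%:A]mulr1 scalerDl addrA.
have d' : derivable (fun h : R => f (h *: w + z) : R) s 1 by rewrite /derivable E.
by apply: DeriveDef => //; rewrite -e /derive E.
Qed.

Section Fibers.
Variables (O : set 'cV[R]_n) (K : set 'cV[R]_m) (c : 'cV[R]_m -> R).
Hypotheses (oO : open O) (cK : compact K) (cc : continuous c).
Let S := [set z : 'cV[R]_(n + m) | O (usubmx z)].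

(** Tube lemma: joint continuity and compactness of K make the convergence as y tends to y0 uniform
    in v. Near each v0 in K, both values are compared with the value over (y0, v0). *)
Lemma tube_uniform (f : 'cV[R]_(n + m) -> R^o) y0 (e : R) :
  (forall z, S z -> {for z, continuous f}) -> O y0 -> 0 < e ->
  \forall y \near y0, forall v, K v -> `|f (col_mx y v) - f (col_mx y0 v)| < e.
Proof.
move=> cf Oy0 e0.
apply: ((@compact_near_coveringP _ K).1 cK _ (nbhs y0)
  (fun y v => `|f (col_mx y v) - f (col_mx y0 v)| < e)) => v0 Kv0.
  have e2 : 0 < e / 2 by rewrite divr_gt0.
  have Sz : S (col_mx y0 v0) by rewrite /S /= col_mxKu.
  have c1 : f (col_mx p.2 p.1) @[p --> (v0, y0)] --> f (col_mx y0 v0).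
    have := @continuous_comp _ _ _ _ f (v0, y0) (@continuous_col_mx (v0, y0)).
    by apply; exact: cf.
  have c2 : f (col_mx y0 v) @[v --> v0] --> f (col_mx y0 v0).
    have := @continuous_comp _ _ _ _ f v0 (@continuous_col_mxr y0 v0).
    by apply; exact: cf.
  have /cvgrPdist_lt/(_ _ e2) n1 := c1.
  have /cvgrPdist_lt/(_ _ e2) n2 := c2.
  have n2' : \forall p \near (v0, y0), `|f (col_mx y0 v0) - f (col_mx y0 p.1)| < e / 2.
    exact: (@cvg_fst _ _ (nbhs v0) (nbhs y0) _ _ n2).
  apply: filterS2 n1 n2' => -[v y] /= h1 h2.
  rewrite (splitr e) -(subrKA (f (col_mx y0 v0))) (le_lt_trans (ler_normD _ _))//.
  by rewrite ltrD// distrC.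
Qed.

(** K is the same for all y in O, and this survives differentiation along the base, so one compact
    set serves for all derivatives. *)
Definition fiber_smooth (f : 'cV[R]_(n + m) -> R^o) : Prop :=
  @smooth_on R _ R^o S f /\ forall y v, O y -> ~ K v -> f (col_mx y v) = 0.

Definition fiber_int (f : 'cV[R]_(n + m) -> R^o) (y : 'cV[R]_n) : R^o :=
  haar_int mu (fun v => (f (col_mx y v) : R) * c v).

Lemma fiber_supported f y : fiber_smooth f -> O y ->
  supported K (fun v => f (col_mx y v) : R).
Proof.
move=> [sf f0] Oy; split => // [v|v nK]; last exact: f0.
apply: (@continuous_comp _ _ _ (fun v => col_mx y v) f); first exact: continuous_col_mxr.
by apply: smooth_cont sf _; rewrite /S /= col_mxKu.
Qed.

(** The constant is a bound for |c| on K times the mass of K. It does not depend on h, which serves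
    both the limits under the integral and the continuity of [push]. *)
Lemma haar_int_mul_bound : exists2 C : R, 0 <= C & forall h e, supported K h ->
  (forall v, K v -> `|h v| <= e) -> 0 <= e -> `|haar_int mu (fun v => h v * c v)| <= e * C.
Proof.
have : compact (c @` K) by apply: continuous_compact => //; exact: continuous_subspaceT.
move=> /compact_bounded [M [Mr hM]]; pose N := `|M| + 1.
have cN v : K v -> `|c v| <= N.
  by move=> Kv; apply: hM; [rewrite (le_lt_trans (ler_norm _))// ltrDl|exists v].
exists (N * fine (mu K)); first by rewrite mulr_ge0 ?fine_ge0 ?measure_ge0 ?addr_ge0.
move=> h e sh he e0; rewrite mulrA; apply: haar_int_bound => //; first exact: supportedM.
by move=> v Kv; rewrite normrM ler_pM// ?he ?cN.
Qed.

Lemma fiber_intB f g y y' (a : R) : fiber_smooth f -> fiber_smooth g -> O y -> O y' ->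
  fiber_int f y - a * fiber_int g y' =
  haar_int mu (fun v => ((f (col_mx y v) : R) - a * (g (col_mx y' v) : R)) * c v).
Proof.
move=> sf sg Oy Oy'; rewrite /fiber_int addrC -mulNr.
rewrite -(haar_intD hmu (K := K)); first by congr haar_int; apply/funext => v; ring.
- by apply: supportedM cc; exact: fiber_supported.
- by apply: supportedM cc; exact: fiber_supported.
Qed.

Lemma supported_fiberB f g y y' (a : R) : fiber_smooth f -> fiber_smooth g -> O y -> O y' ->
  supported K (fun v => (f (col_mx y v) : R) - a * (g (col_mx y' v) : R)).
Proof.
move=> sf sg Oy Oy'.
have := supportedD (- a) (fiber_supported sg Oy') (fiber_supported sf Oy).
by under [X in supported K X -> _]funext do rewrite addrC mulNr.
Qed.

(** The direction (u, 0) is tangent to the base: over v outside K the function vanishes along the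
    line as long as the base point stays in the open set O, hence so does its derivative. *)
Lemma fiber_smooth_derive f u : fiber_smooth f -> fiber_smooth ('D_(col_mx u 0) f).
Proof.
move=> [sf f0]; split=> [|y v Oy nK]; first exact: smooth_derive.
pose g : R -> 'cV[R]_n := fun h => h *: u + y.
have cg : {for 0, continuous g}.
  apply: (@continuousD _ _ _ _ (cst y)); last exact: cst_continuous.
  by apply: (@continuousZr_tmp); exact: cvg_id.
have Og : \forall h \near (0 : R), O (g h).
  by apply: cg; rewrite /g scale0r add0r; exact: open_nbhs_nbhs.
rewrite /derive; apply/cvg_lim => //; apply: cvg_trans (near_eq_cvg _) (cvg_cst _).
apply: nbhs_dnbhs; apply: filterS Og => h Ogh /=.
by rewrite scale_col_mx add_col_mx scaler0 add0r !f0// subr0 scaler0.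
Qed.

Lemma fiber_int_continuous f y0 : fiber_smooth f -> O y0 ->
  {for y0, continuous (fiber_int f)}.
Proof.
move=> sf Oy0; have [C C0 hC] := haar_int_mul_bound.
apply: continuous_dist => e e0.
(* The tolerance is divided by C + 1 because C may be 0. *)
have d0 : 0 < e / (C + 1) by rewrite divr_gt0// ltr_wpDl.
have cf z : S z -> {for z, continuous f} by move: (sf) => [s _]; exact: smooth_cont s.
have := tube_uniform cf Oy0 d0.
apply: filterS2 (open_nbhs_nbhs (conj oO Oy0)) => y Oy hy.
rewrite -[fiber_int f y0]mul1r fiber_intB//.
apply: (@le_trans _ _ (e / (C + 1) * C)).
  apply: hC; [exact: supported_fiberB| |exact: ltW].
  by move=> v Kv; rewrite mul1r ltW// hy.
by rewrite mulrAC ler_pdivrMr ?ltr_wpDl// ler_wpM2l ?(ltW e0)// lerDl.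
Qed.

(** By the mean value theorem the increment of f over v in K differs from t Df(y0, v) by at most |t|
    times the variation of Df near y0, which is small uniformly in v by [tube_uniform]; this
    estimate is then integrated. *)
Lemma fiber_int_is_derive f u y0 : fiber_smooth f -> O y0 ->
  is_derive y0 u (fiber_int f) (fiber_int ('D_(col_mx u 0) f) y0).
Proof.
move=> sf Oy0; have [C C0 hC] := haar_int_mul_bound.
pose w : 'cV[R]_(n + m) := col_mx u 0; pose Df := 'D_w f.
have sDf : fiber_smooth Df by exact: fiber_smooth_derive.
suff cvg : (fun h : R => h^-1 *: ((fiber_int f \o shift y0) (h *: u) - fiber_int f y0)) @ 0^'
    --> fiber_int Df y0.
  have d : derivable (fiber_int f) y0 u by apply/cvg_ex; eexists; exact: cvg.
  by apply: DeriveDef => //; exact: cvg_lim cvg.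
apply/cvgrPdist_le => e e0.
have d0 : 0 < e / (C + 1) by rewrite divr_gt0// ltr_wpDl.
have cD z : S z -> {for z, continuous Df} by move: (sDf) => [s _]; exact: smooth_cont s.
pose g : R -> 'cV[R]_n := fun h => h *: u + y0.
have g0 : g 0 = y0 by rewrite /g scale0r add0r.
have cg : g h @[h --> 0] --> y0.
  suff : {for 0, continuous g} by rewrite /prop_for /continuous_at g0.
  apply: (@continuousD _ _ _ _ (cst y0)); last exact: cst_continuous.
  by apply: (@continuousZr_tmp); exact: cvg_id.
have /nbhs_ballP[d /= dpos hd] : \forall h \near (0 : R), O (g h) /\
    forall v, K v -> `|Df (col_mx (g h) v) - Df (col_mx y0 v)| < e / (C + 1).
  apply: (cg [set y | O y /\
    forall v, K v -> `|Df (col_mx y v) - Df (col_mx y0 v)| < e / (C + 1)]).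
  apply: filterI; first exact: open_nbhs_nbhs.
  exact: tube_uniform.
near=> t.
have t0 : t != 0 by near: t; exact: nbhs_dnbhs_neq.
have td : `|t| < d by near: t; exact: dnbhs0_lt.
have hd' s : `|s| < d -> O (g s) /\
    forall v, K v -> `|Df (col_mx (g s) v) - Df (col_mx y0 v)| < e / (C + 1).
  by move=> sd; apply: hd; rewrite -ball_normE /ball_ /= sub0r normrN.
have Ogt : O (g t) by have [] := hd' t td.
rewrite distrC.
have mv v : K v -> `|(f (col_mx (g t) v) : R) - f (col_mx y0 v) - t * Df (col_mx y0 v)|
    <= `|t| * (e / (C + 1)).
  move=> Kv; pose z : 'cV[R]_(n + m) := col_mx y0 v.
  have E s : s *: w + z = col_mx (g s) v.
    by rewrite /w /z scale_col_mx add_col_mx scaler0 add0r.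
  have [|s sd] := @mean_value (fun h : R => f (h *: w + z) : R)
      (fun s => Df (s *: w + z)) d t td.
    move=> s sd; apply: is_derive_along; move: (sf) => [s' _].
    apply: smooth_is_derive s' _; rewrite E /S /= col_mxKu.
    by have [] := hd' s sd.
  rewrite !E g0 => ->; rewrite mulrC -mulrBr normrM ler_wpM2l//.
  by have [_ h] := hd' s sd; rewrite ltW// h.
have tt : `|t| != 0 by rewrite normr_eq0.
have -> : t^-1 *: ((fiber_int f \o shift y0) (t *: u) - fiber_int f y0) - fiber_int Df y0 =
   t^-1 * haar_int mu (fun v => ((f (col_mx (g t) v) : R) - f (col_mx y0 v)
        - t * Df (col_mx y0 v)) * c v).
  have s1 := supported_fiberB 1 sf sf Ogt Oy0.
  have s2 := fiber_supported sDf Oy0.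
  have -> : haar_int mu (fun v => ((f (col_mx (g t) v) : R) - f (col_mx y0 v)
        - t * Df (col_mx y0 v)) * c v) = - t * fiber_int Df y0 +
         (fiber_int f (g t) - 1 * fiber_int f y0).
    rewrite fiber_intB// -(haar_intD hmu (K := K)).
    - by congr haar_int; apply/funext => v; ring.
    - exact: supportedM.
    - exact: supportedM.
  by rewrite /GRing.scale /= /g; field.
rewrite normrM normfV ler_pdivrMl ?normr_gt0//.
apply: (@le_trans _ _ ((`|t| * (e / (C + 1))) * C)).
  apply: hC => //; last by rewrite mulr_ge0// ltW.
  have := supportedD (- t) (fiber_supported sDf Oy0) (supported_fiberB 1 sf sf Ogt Oy0).
  rewrite (_ : (fun x => _) = (fun v => (f (col_mx (g t) v) : R) - f (col_mx y0 v)
        - t * Df (col_mx y0 v)))//.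
  by apply/funext => v; ring.
rewrite -mulrA ler_wpM2l//.
by rewrite mulrAC ler_pdivrMr ?ltr_wpDl// ler_wpM2l ?(ltW e0)// lerDl.
Unshelve. all: by end_near. Qed.

Lemma fiber_int_smooth f : fiber_smooth f -> @smooth_on R _ R^o O (fiber_int f).
Proof.
move=> sf; apply: (@smooth_coind _ _ _
   (fun h => exists2 f, fiber_smooth f & h = fiber_int f)) => //.
- by move=> _ x [h sh ->] Ox; exact: fiber_int_continuous.
- move=> _ v [h sh ->]; exists (fiber_int ('D_(col_mx v 0) h)).
    by exists ('D_(col_mx v 0) h) => //; exact: fiber_smooth_derive.
  by move=> x Ox; exact: fiber_int_is_derive.
- by exists f.
Qed.

Lemma fiber_smooth_dirD f vs : fiber_smooth f ->
  fiber_smooth (dirD [seq col_mx v 0 | v <- vs] f).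
Proof. by move=> sf; elim: vs => //= v vs IH; exact: fiber_smooth_derive. Qed.

(** Beyond smoothness, the seminorm estimates need this explicit form of every derivative. *)
Lemma dirD_fiber_int f vs y : fiber_smooth f -> O y ->
  dirD vs (fiber_int f) y = fiber_int (dirD [seq col_mx v 0 | v <- vs] f) y.
Proof.
move=> sf; elim: vs y => [//|v vs IH] y Oy /=.
have E : {in O, dirD vs (fiber_int f) =1 fiber_int (dirD [seq col_mx v 0 | v <- vs] f)}.
  by move=> x; rewrite inE; exact: IH.
rewrite (near_eq_derive _ (open_near_eq oO E Oy)).
by have [_ ->] := fiber_int_is_derive v (fiber_smooth_dirD vs sf) Oy.
Qed.

End Fibers.
End ParametricIntegral.

(** * Powers of vectors in the symmetric power *)

Section SymmetricPowers.
Context {R : realType} (m k : nat).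
Local Notation V := 'cV[R]_m.
Local Notation L := (Sym R m k).

Definition vec_form (v : V) : mpoly m R := \sum_(i < m) v i 0 *: mpolyX R (mnm1 i).

Lemma vec_formD v w (t : R) : vec_form (t *: w + v) = t *: vec_form w + vec_form v.
Proof.
rewrite /vec_form scaler_sumr -big_split; apply: eq_bigr => i _ /=.
by rewrite !mxE scalerDl scalerA.
Qed.

Lemma vec_form_delta i : vec_form (delta_mx i 0) = mpolyX R (mnm1 i).
Proof.
rewrite /vec_form (bigD1 i)//= big1 => [|j ji].
  by rewrite addr0 mxE !eqxx scale1r.
by rewrite mxE (negbTE ji) scale0r.
Qed.

Lemma vec_form_homog v : vec_form v ^+ k \is ishomog1 k (@mdeg m).
Proof.
rewrite -[X in ishomog1 X]mul1n; apply: dhomogMn; apply: rpred_sum => i _.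
by apply: rpredZ; rewrite dhomogX /= mdeg1.
Qed.

Definition vec_pow (v : V) : L := DHomog (vec_form_homog v).

(** Substitution is a ring morphism, hence commutes with the k-th power; in degree 1 it is the
    matrix product. *)
Lemma sym_map_vec_pow (A : 'M[R]_m) v : sym_map A (vec_pow v) = vec_pow (A *m v).
Proof.
apply: val_inj => /=; rewrite rmorphXn /=; congr (_ ^+ k).
rewrite /vec_form linear_sum /=.
under eq_bigr => j _ do rewrite linearZ /= comp_mpolyXU -tnth_nth tnth_mktuple scaler_sumr.
rewrite exchange_big /=; apply: eq_bigr => i _.
rewrite mxE scaler_suml; apply: eq_bigr => j _.
by rewrite scalerA mulrC.
Qed.

Lemma sym_map_linear (A : 'M[R]_m) (c : R) (p q : L) :
  sym_map A (c *: p + q) = c *: sym_map A p + sym_map A q.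
Proof. by apply: val_inj => /=; rewrite linearP. Qed.

(** Exponents of degree less than k + 1 form a finite type; those of degree exactly k index the
    monomial basis of the symmetric power. *)
Definition sym_idx : finType := {e : bmultinom m k.+1 | mdeg (bmnm e) == k}.
Definition sym_mnm (i : sym_idx) : multinom m := bmnm (val i).

Lemma sym_mnm_homog (i : sym_idx) : mpolyX R (sym_mnm i) \is ishomog1 k (@mdeg m).
Proof. by rewrite dhomogX /=; exact: (valP i). Qed.

Definition sym_base (i : sym_idx) : L := DHomog (sym_mnm_homog i).
Definition sym_coord (i : sym_idx) (p : L) : R := mcoeff (sym_mnm i) (val p).

Lemma sym_coord_linear i (c : R) p q :
  sym_coord i (c *: p + q) = c * sym_coord i p + sym_coord i q.
Proof. by rewrite /sym_coord /= mcoeffD mcoeffZ. Qed.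

Lemma sym_coordE (p : L) : p = \sum_i sym_coord i p *: sym_base i.
Proof.
apply: val_inj; apply/mpolyP => e; rewrite (raddf_sum (val : L -> mpoly m R)) /=.
rewrite (raddf_sum (mcoeff e)) /=.
under eq_bigr => i _ do rewrite mcoeffZ mcoeffX.
have [ek|ek] := eqVneq (mdeg e) k; last first.
  rewrite big1 => [|i _]; first by apply: dhomog_nemf_coeff ek; exact: valP.
  have [E|_] := eqVneq (sym_mnm i) e; last by rewrite mulr0.
  by move: ek; rewrite -E (eqP (valP i)) eqxx.
have be : (mdeg e < k.+1)%N by rewrite ek.
pose i0 : sym_idx := Sub (BMultinom be) (introT eqP ek).
rewrite (bigD1 i0)//= big1 => [|i ii0]; first by rewrite addr0 eqxx mulr1.
have [E|_] := eqVneq (sym_mnm i) e; last by rewrite mulr0.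
by case/eqP: ii0; do 2 apply: val_inj => /=; exact: E.
Qed.

Lemma smooth_vec_pow_coord i (O : set V) : open O ->
  @smooth_on R _ R^o O (fun v => sym_coord i (vec_pow v)).
Proof.
(* Distributing the k-th power of a sum over all maps f from factors to variables exhibits each
   coordinate as a polynomial in the coordinates of v. *)
move=> oO; pose F (v : V) : R^o := \sum_(f : {ffun 'I_k -> 'I_m})
   (\prod_(j < k) v (f j) 0) * mcoeff (sym_mnm i) (\prod_(j < k) mpolyX R (mnm1 (f j))).
apply: (@smooth_eq _ _ O F) => //; last first.
  apply: smooth_sum => // f _; apply: smoothM => //; last exact: smooth_cst.
  by apply: smooth_prod => // j; exact: smooth_coord.
move=> v _; rewrite /F /sym_coord /= -[in RHS](card_ord k) -prodr_const.
rewrite bigA_distr_bigA /= raddf_sum /=; apply: eq_bigr => f _.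
by rewrite scaler_prod mcoeffZ.
Qed.

Lemma poly_eq0_near (p : {poly R}) : (\forall t \near (0 : R), p.[t] = 0) -> p = 0.
Proof.
move=> /nbhs_ballP[d /= d0 hd]; apply/eqP/negPn/negP => p0.
(* As many points as the size of p, hence more than its degree; the shift by 2 keeps even the first
   one strictly inside the ball of radius d. *)
pose s := [seq d / (i.+2)%:R | i <- iota 0 (size p)].
have us : uniq s.
  rewrite map_inj_uniq ?iota_uniq// => i j /(mulfI (lt0r_neq0 d0))/invr_inj/eqP.
  by rewrite eqr_nat => /eqP[].
have rs : all (root p) s.
  apply/allP => _ /mapP[i _ ->]; rewrite rootE; apply/eqP/hd.
  rewrite -ball_normE /ball_ /= sub0r normrN ger0_norm ?divr_ge0 ?ltW//.
  by rewrite ltr_pdivrMr// ltr_pMr// ltr1n.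
by have := max_poly_roots p0 rs us; rewrite size_map size_iota ltnn.
Qed.

Section Polarization.
Variables (l : mpoly m R -> R) (O : set V).
Hypotheses (ll : linear_for *%R l) (oO : open O).

Let l0 : l 0 = 0.
Proof. by have := ll (-1) 0 0; rewrite scaler0 addr0 mulN1r addNr. Qed.

Let lZ (c : R) p : l (c *: p) = c * l p.
Proof. by have := ll c p 0; rewrite !addr0 l0 addr0. Qed.

Let lsum (I : finType) (F : I -> mpoly m R) : l (\sum_i F i) = \sum_i l (F i).
Proof.
elim/big_rec2: _ => [//|i x y _ <-].
by have := ll 1 (F i) y; rewrite scale1r mul1r.
Qed.

(* Differentiate at [v] in the direction of the i-th basis vector. *)
Lemma polarization_step j i q :
  (forall v, O v -> l (vec_form v ^+ j.+1 * q) = 0) ->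
  forall v, O v -> l (vec_form v ^+ j * (mpolyX R (mnm1 i) * q)) = 0.
Proof.
move=> h v Ov; pose w : V := delta_mx i 0.
(* By the binomial formula p(t) = l ((v + t w)^(j+1) q), which vanishes for small t; its coefficient
   at t is (j + 1) l (v^j w q). *)
pose p : {poly R} := \poly_(s < j.+2)
   (l (vec_form v ^+ (j.+1 - s) * vec_form w ^+ s * q) *+ 'C(j.+1, s)).
have hp t : p.[t] = l (vec_form (t *: w + v) ^+ j.+1 * q).
  rewrite /p horner_poly vec_formD addrC exprDn mulr_suml lsum.
  apply: eq_bigr => s _; rewrite exprZn.
  have E (x y : mpoly m R) (a : R) c :
      (x * (a *: y)) *+ c * q = (a * c%:R) *: (x * y * q).
    by rewrite -scalerAr -[_ *+ c]scaler_nat scalerA -scalerAl mulrC.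
  by rewrite E lZ -mulr_natl; ring.
have : p = 0.
  apply: poly_eq0_near; have cg : {for 0, continuous (fun t : R => t *: w + v)}.
    apply: (@continuousD _ _ _ _ (cst v)); last exact: cst_continuous.
    by apply: (@continuousZr_tmp); exact: cvg_id.
  have : \forall t \near (0 : R), O (t *: w + v).
    by apply: cg; rewrite scale0r add0r; exact: open_nbhs_nbhs.
  by apply: filterS => t Ot; rewrite hp h.
move/(congr1 (fun p : {poly R} => p`_1)); rewrite coef0 coef_poly /= bin1 subn1 expr1.
rewrite vec_form_delta -mulrA -mulr_natr => /eqP; rewrite mulf_eq0 pnatr_eq0 orbF.
by move/eqP.
Qed.

(** Induction on the number d of factors of v^k already replaced by variables, for all v in O at
    once; at d = k no factor v is left. *)
Lemma polarization : (forall v, O v -> l (vec_form v ^+ k) = 0) -> O !=set0 ->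
  forall e, mdeg e = k -> l (mpolyX R e) = 0.
Proof.
move=> h [v0 Ov0].
suff H : forall d, (d <= k)%N -> forall e, mdeg e = d ->
    forall v, O v -> l (vec_form v ^+ (k - d) * mpolyX R e) = 0.
  by move=> e ek; have := H k (leqnn k) e ek v0 Ov0; rewrite subnn expr0 mul1r.
elim=> [_ e /eqP|d IH dk e ed v Ov].
  by rewrite mdeg_eq0 => /eqP -> v Ov; rewrite mpolyX0 mulr1 subn0 h.
have [i ei] : exists i, (0 < e i)%N.
  apply/existsP; apply: contra_eqT ed; rewrite negb_exists => /forallP e0.
  by rewrite mdegE big1// => i _; apply/eqP; rewrite -leqn0 leqNgt e0.
have E : e = mnm_add (mnm1 i) (mnm_sub e (mnm1 i)).
  apply/mnmP => j; rewrite mnmDE mnmBE mnm1E.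
  by case: eqP => [<-|_]; rewrite ?subn0 ?subnKC.
have ed' : mdeg (mnm_sub e (mnm1 i)) = d.
  by move: ed; rewrite {1}E mdegD mdeg1 => -[].
rewrite E mpolyXD; apply: polarization_step Ov => u Ou.
by rewrite -subnSK// in IH *; apply: IH => //; exact: ltnW.
Qed.

End Polarization.
End SymmetricPowers.

(** * Moments and dual bump functions *)

Section Moments.
Context {R : realType} (m k : nat).
Local Notation V := 'cV[R]_m.
Local Notation L := (Sym R m k).
Local Notation I := (sym_idx m k).
Variable mu : {measure set (borelV R m) -> \bar R}.
Hypothesis hmu : is_haar mu.

Definition pow_coord (i : I) (v : V) : R := sym_coord i (vec_pow k v).

Lemma pow_coord_smooth i : @smooth_on R _ R^o setT (pow_coord i).
Proof. exact/smooth_vec_pow_coord/openT. Qed.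

Lemma pow_coord_continuous i : continuous (pow_coord i).
Proof. exact: smooth_continuous (pow_coord_smooth i). Qed.

Lemma sym_coord_base (i j : I) : sym_coord i (sym_base j) = (i == j)%:R :> R.
Proof.
rewrite /sym_coord /= mcoeffX; congr (nat_of_bool _)%:R.
by rewrite eq_sym -[RHS]val_eqE -[RHS]val_eqE.
Qed.

(* A vector in the kernel of the Gram matrix is a linear form on the symmetric
   power that vanishes at [v ^ k] wherever [b v > 0]; polarization applies. *)
Lemma gram_unit (b : V -> R) K u : supported K b -> (forall v, 0 <= b v) -> 0 < b u ->
  (\matrix_(i, j) haar_int mu (fun v => b v * pow_coord (enum_val i) v
     * pow_coord (enum_val j) v) : 'M[R]_#|I|) \in unitmx.
Proof.
move=> sb b0 bu; set G := (X in X \in _); have [cK cb bK] := sb.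
rewrite -row_free_unit; apply: inj_row_free => x xG.
pose l (p : mpoly m R) : R := \sum_(i < #|I|) x 0 i * mcoeff (sym_mnm (enum_val i)) p.
have ll : linear_for *%R l.
  move=> c p q; rewrite /l mulr_sumr -big_split; apply: eq_bigr => i _ /=.
  by rewrite mcoeffD mcoeffZ mulrDr mulrCA.
have lE v : l (vec_form v ^+ k) = \sum_(i < #|I|) x 0 i * pow_coord (enum_val i) v by [].
have sbc (i : 'I_#|I|) : supported K (fun v => b v * pow_coord (enum_val i) v).
  by apply: supportedM => //; exact: pow_coord_continuous.
have sbcc (i j : 'I_#|I|) : supported K (fun v => b v * pow_coord (enum_val i) v * pow_coord (enum_val j) v).
  by apply: supportedM => //; exact: pow_coord_continuous.
have SES (j : 'I_#|I|) := haar_int_sum hmu (index_enum 'I_#|I|) (x 0) cK (sbcc ^~ j).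
have [sT ET] := haar_int_sum hmu (index_enum 'I_#|I|) (x 0) cK (fun j => (SES j).1).
(* Expanding the square shows that the integral of b l(v^k)^2 is x G x^T, which is 0. *)
have QE : (fun v => b v * (l (vec_form v ^+ k)) ^+ 2) =
   (fun v => \sum_j x 0 j * (\sum_i x 0 i *
       (b v * pow_coord (enum_val i) v * pow_coord (enum_val j) v))).
  apply/funext => v; rewrite lE expr2 mulr_sumr mulr_sumr; apply: eq_bigr => j _.
  by rewrite [in LHS]mulr_suml !mulr_sumr; apply: eq_bigr => i _; ring.
have Q0 : haar_int mu (fun v => b v * (l (vec_form v ^+ k)) ^+ 2) = 0.
  rewrite QE ET big1// => j _; rewrite (SES j).2.
  have := congr1 (fun M : 'rV_#|I| => M 0 j) xG; rewrite !mxE => xGj.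
  rewrite -[RHS](mulr0 (x 0 j)) -[in RHS]xGj; congr (_ * _).
  by apply: eq_bigr => i _; rewrite mxE.
pose O := [set v | 0 < b v].
have oO : open O by have /continuousP/(_ [set y | 0 < y]) := cb; apply; exact: open_gt.
have lO v : O v -> l (vec_form v ^+ k) = 0.
  move=> Ov; apply/eqP/negPn/negP => l0.
  have : 0 < haar_int mu (fun v => b v * (l (vec_form v ^+ k)) ^+ 2).
    apply: (@haar_int_gt0 _ _ _ hmu K _ v); first by rewrite QE.
      by move=> w; rewrite mulr_ge0 ?sqr_ge0.
    by rewrite mulr_gt0// exprn_even_gt0.
  by rewrite Q0 ltxx.
have lX := polarization ll oO lO (ex_intro _ u bu).
apply/rowP => i; rewrite mxE; have := lX _ (eqP (valP (enum_val i))).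
rewrite /l (bigD1 i)//= big1 => [|j ji].
  by rewrite mcoeffX eqxx mulr1 addr0.
rewrite mcoeffX; have [E|_] := eqVneq _ (sym_mnm _); last by rewrite mulr0.
by case/eqP: ji; apply: enum_val_inj; do 2 apply: val_inj.
Qed.

Lemma dual_bumps (U : set V) : open U -> U !=set0 ->
  exists (phi : I -> V -> R^o) K, [/\ compact K, K `<=` U,
    forall i, @smooth_on R _ R^o setT (phi i),
    forall i, supported K (phi i) &
    forall i j, haar_int mu (fun v => (phi i v : R) * pow_coord j v) = (i == j)%:R].
Proof.
move=> oU [u Uu]; have [b [sb b0 bu [K [cK KU bK]]]] := bump_exists oU Uu.
have sK : supported K b by split => //; exact: smooth_continuous.
have := gram_unit sK b0 bu; set G := (X in X \in _) => Gu.
have sbc (j : 'I_#|I|) : supported K (fun v => b v * pow_coord (enum_val j) v).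
  by apply: supportedM => //; exact: pow_coord_continuous.
(* The coefficients form a row of the inverse Gram matrix, so the integrals against the coordinates
   of v^k are the entries of G^-1 G. *)
pose phi i v : R := \sum_(j < #|I|) invmx G (enum_rank i) j *
   (b v * pow_coord (enum_val j) v).
exists phi, K; split => //.
- move=> i; apply: smooth_sum; first exact: openT.
  move=> j _; apply: smoothZ; first exact: openT.
  by apply: smoothM; [exact: openT| |exact: pow_coord_smooth].
- move=> i.
  by have [] := haar_int_sum hmu (index_enum 'I_#|I|) (invmx G (enum_rank i)) cK sbc.
- move=> i j.
  have sbcc (l : 'I_#|I|) : supported K (fun v => b v * pow_coord (enum_val l) v * pow_coord j v).
    by apply: supportedM => //; exact: pow_coord_continuous.
  have [_] := haar_int_sum hmu (index_enum 'I_#|I|) (invmx G (enum_rank i)) cK sbcc.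
  rewrite (_ : (fun x => _) = (fun v => phi i v * pow_coord j v)) => [->|]; last first.
    by apply/funext => v; rewrite mulr_suml; apply: eq_bigr => l _; ring.
  have := congr1 (fun M : 'M[R]_#|I| => M (enum_rank i) (enum_rank j)) (mulVmx Gu).
  rewrite !mxE (inj_eq enum_rank_inj) => <-; apply: eq_bigr => l _.
  by rewrite mxE enum_rankK.
Qed.

(** The integral of h(v) v^k, taken coordinate by coordinate so that only scalar integrals occur. *)
Definition moment (h : V -> R) : L :=
  \sum_i haar_int mu (fun v => h v * pow_coord i v) *: sym_base i.

Lemma supported_pow K h i : supported K h -> supported K (fun v => h v * pow_coord i v).
Proof. by move=> sh; apply: supportedM => //; exact: pow_coord_continuous. Qed.

(** Linear forms commute with the integral, which describes the moment without coordinates. It is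
    applied to coordinates, to coordinates composed with [sym_map], and to the forms that test
    smoothness. *)
Lemma linear_moment (l : L -> R) K h : linear_for *%R l -> supported K h ->
  l (moment h) = haar_int mu (fun v => h v * l (vec_pow k v)).
Proof.
move=> ll sh; have [cK _ _] := sh.
have l0 : l 0 = 0 by have := ll (-1) 0 0; rewrite scaler0 addr0 mulN1r addNr.
have lS (F : I -> R) : l (\sum_i F i *: sym_base i) = \sum_i F i * l (sym_base i).
  by elim/big_rec2: _ => [//|i x y _ <-]; rewrite ll.
rewrite /moment lS.
have [_] := haar_int_sum hmu (index_enum I) (fun i => l (sym_base i)) cK
   (fun i => supported_pow i sh).
under [in RHS]eq_bigr do rewrite mulrC.
move=> <-; congr haar_int; apply/funext => v.
rewrite [X in l X]sym_coordE lS mulr_sumr; apply: eq_bigr => i _.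
by rewrite mulrCA [l _ * _]mulrC.
Qed.

Lemma sym_coord_moment i K h : supported K h ->
  sym_coord i (moment h) = haar_int mu (fun v => h v * pow_coord i v).
Proof. by move=> sh; rewrite (linear_moment _ sh)// => c p q; exact: sym_coord_linear. Qed.

Lemma sym_coord_inj (p q : L) : (forall i, sym_coord i p = sym_coord i q) -> p = q.
Proof. by move=> h; rewrite [p]sym_coordE [q]sym_coordE; apply: eq_bigr => i _; rewrite h. Qed.

Lemma momentD K c h1 h2 : supported K h1 -> supported K h2 ->
  moment (fun v => c * h1 v + h2 v) = c *: moment h1 + moment h2.
Proof.
move=> s1 s2; apply: sym_coord_inj => i.
rewrite sym_coord_linear (sym_coord_moment _ s1) (sym_coord_moment _ s2).
rewrite (sym_coord_moment _ (supportedD c s1 s2)).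
rewrite -(haar_intD hmu c (supported_pow i s1) (supported_pow i s2)).
by congr haar_int; apply/funext => v; ring.
Qed.

Lemma moment0 : moment (fun=> 0) = 0.
Proof.
rewrite /moment big1// => i _; under [X in haar_int _ X]funext do rewrite mul0r.
by rewrite haar_int0 ?scale0r.
Qed.

(** Substitute w = A v: then v^k = (B w)^k is the image of w^k under [sym_map B], and mu is
    unchanged. *)
Lemma moment_mulmx (A B : 'M[R]_m) K h : A *m B = 1%:M -> B *m A = 1%:M ->
  (forall E : set (borelV R m), measurable E ->
     mu [set (B *m w : V) | w in (E : set V)] = mu E) ->
  supported K h -> moment (fun v => h (A *m v)) = sym_map B (moment h).
Proof.
move=> AB BA inv sh; have [cK ch hK] := sh.
have cA : continuous (fun v : V => A *m v) by exact: continuous_mulmxl.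
have cB : continuous (fun v : V => B *m v) by exact: continuous_mulmxl.
have EK : [set x | K (A *m x)] = (fun v => B *m v) @` K.
  apply/seteqP; split => [x Kx|_ [x Kx <-]]; last by rewrite /= mulmxA AB mul1mx.
  by exists (A *m x) => //; rewrite mulmxA BA mul1mx.
have cK' : compact [set x | K (A *m x)].
  by rewrite EK; apply: continuous_compact => //; exact: continuous_subspaceT.
have sA f : supported K f -> supported [set x | K (A *m x)] (fun v => f (A *m v)).
  move=> [_ cf f0]; split => // [v|v nK]; last exact: f0.
  by apply: (@continuous_comp _ _ _ (fun v : V => A *m v) f); [exact: cA|exact: cf].
apply: sym_coord_inj => i; rewrite (sym_coord_moment i (sA _ sh)).
have -> : sym_coord i (sym_map B (moment h)) =
    haar_int mu (fun v => h v * sym_coord i (sym_map B (vec_pow k v))).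
  rewrite -(@linear_moment (fun p => sym_coord i (sym_map B p)) K h)// => c p q.
  by rewrite sym_map_linear sym_coord_linear.
have sH : supported K (fun v => h v * sym_coord i (sym_map B (vec_pow k v))).
  rewrite (_ : (fun v => _) = (fun v => h v * (pow_coord i \o (fun v => B *m v)) v)).
    apply: supportedM => // v; apply: continuous_comp; [exact: cB|exact: pow_coord_continuous].
  by apply/funext => v; rewrite sym_map_vec_pow.
rewrite -(haar_int_invariant hmu AB BA inv sH (sA _ sH)).
congr haar_int; apply/funext => v; rewrite sym_map_vec_pow mulmxA BA mul1mx.
by [].
Qed.

End Moments.

(** * Integration along the fibers of the projection to X *)

Section Pushforward.
Context {R : realType} (m k : nat).
Local Notation V := 'cV[R]_m.
Local Notation L := (Sym R m k).
Local Notation C := (R[i]^o).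
Local Notation Re := complex.Re.
Local Notation Im := complex.Im.

(** A complex-linear form whose real part is Re for c = 1 and Im for c = - i, so that both parts of
    a scalar function are instances of [local_rep]. *)
Definition mulc (c : R[i]) (z : C) : C := c * z.

Lemma mulc_linear c : linear (mulc c).
Proof. by move=> a x y; rewrite /mulc /GRing.scale /=; ring. Qed.

HB.instance Definition _ c := GRing.isLinear.Build R[i] C C _ (mulc c) (mulc_linear c).

Lemma Re_mulc1 z : Re (mulc 1 z) = Re z.
Proof. by rewrite /mulc mul1r. Qed.

Lemma Re_mulcNi z : Re (mulc (- 'i)%C z) = Im z.
Proof. by case: z => x y; rewrite /mulc /=; ring. Qed.

Context {X : topologicalType} (n : nat) (AX : set (chart R X n)).
Hypothesis hX : smooth_manifold AX.
Local Notation AV := (prod_atlas AX (euclid_atlas R m)).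

Definition pchart (phi : chart R X n) : chart R (X * V)%type (n + m) :=
  prod_chart phi (Chart setT id id).

Lemma pchart_atlas phi : AX phi -> AV (pchart phi).
Proof. by move=> Aphi; exists phi, (Chart setT id id). Qed.

Lemma pchart_cod phi : ccod (pchart phi) = [set z | ccod phi (usubmx z)].
Proof.
apply/seteqP; split => [_ [[x v] [/= px _] <-]|z /= [x px xz]].
  by rewrite /= col_mxKu; exists x.
by exists (x, dsubmx z) => //=; rewrite xz vsubmxK.
Qed.

Variable mu : {measure set (borelV R m) -> \bar R}.
Hypothesis hmu : is_haar mu.

Definition push (f : X * V -> C) (x : X) : cplx L :=
  (moment k mu (fun v => Re (f (x, v))), moment k mu (fun v => Im (f (x, v)))).

Section Support.
Variables (K : set (X * V)) (f : X * V -> C) (O : set (X * V)).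
Hypotheses (cK : compact K) (tf : test_function AV O f) (fK : vanishes_off K f).
Let K2 := snd @` K.

Lemma compact_snd : compact K2.
Proof.
by apply: continuous_compact => //; apply: continuous_subspaceT => p; exact: cvg_snd.
Qed.

Lemma pchart_fiber_smooth phi c : AX phi ->
  fiber_smooth (ccod phi) K2 (local_rep (pchart phi) (mulc c) f).
Proof.
move=> Aphi; split.
  by rewrite -pchart_cod; have [sf _] := tf; apply/sf/pchart_atlas.
move=> y v _ nK; rewrite /local_rep /= col_mxKd fK ?raddf0// => Kv.
by apply: nK; eexists; first exact: Kv.
Qed.

Lemma chart_at (x : X) : exists2 phi, AX phi & exists2 y, ccod phi y & cinv phi y = x.
Proof.
have [_ _ hc hcov _] := hX; have [phi Aphi px] := hcov x; exists phi => //.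
have [_ _ fK' _ _] := hc _ Aphi.
by exists (cfun phi x); [exists x|rewrite fK'// inE].
Qed.

Lemma open_ccod phi : AX phi -> open (ccod phi).
Proof. by have [_ _ hc _ _] := hX => /hc[]. Qed.

(** For fixed x, continuity in v is read in a chart around x, where the local representation is
    smooth. *)
Lemma supported_Re_mulc c x : supported K2 (fun v => Re (mulc c (f (x, v)))).
Proof.
have [phi Aphi [y py <-]] := chart_at x.
have := fiber_supported compact_snd (pchart_fiber_smooth c Aphi) py.
by congr supported; apply/funext => v; rewrite /local_rep /= col_mxKu col_mxKd.
Qed.

Lemma supported_Re x : supported K2 (fun v => Re (f (x, v))).
Proof.
have := supported_Re_mulc 1 x.
by under [X in supported _ X -> _]funext do rewrite Re_mulc1.
Qed.

Lemma supported_Im x : supported K2 (fun v => Im (f (x, v))).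
Proof.
have := supported_Re_mulc (- 'i)%C x.
by under [X in supported _ X -> _]funext do rewrite Re_mulcNi.
Qed.

Lemma push_off : vanishes_off (fst @` K) (push f).
Proof.
move=> x nK; have f0 v : f (x, v) = 0.
  by apply: fK => Kv; apply: nK; eexists; first exact: Kv.
rewrite /push (_ : (fun v => Re _) = fun=> 0); last by apply/funext => v; rewrite f0.
rewrite (_ : (fun v => Im _) = fun=> 0); last by apply/funext => v; rewrite f0.
by rewrite moment0.
Qed.

(** Together with [form2], the real-linear forms into which Re l splits along the real and imaginary
    summands of the complexification. *)
Definition form1 (l : {linear cplx L -> C}) (p : L) : R := Re (l (p, 0)).
Definition form2 (l : {linear cplx L -> C}) (p : L) : R := Re (l (0, p)).

Let realify (l : {linear cplx L -> C}) (a : R) (z w : cplx L) :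
  Re (l ((a *: z.1, a *: z.2) + w)) = a * Re (l z) + Re (l w).
Proof.
have -> : (a *: z.1, a *: z.2) = a%:C *: z.
  by rewrite /GRing.scale /= /cplx_scale /= !scale0r subr0 addr0.
rewrite linearP; case: (l z) => x y; case: (l w) => x' y'.
by rewrite /GRing.scale /=; ring.
Qed.

Lemma form1_linear l : linear_for *%R (form1 l).
Proof.
move=> a p q; rewrite /form1 -realify /=; congr (Re (l _)).
by congr pair => /=; rewrite ?scaler0 ?addr0.
Qed.

Lemma form2_linear l : linear_for *%R (form2 l).
Proof.
move=> a p q; rewrite /form2 -realify /=; congr (Re (l _)).
by congr pair => /=; rewrite ?scaler0 ?addr0.
Qed.

Lemma Re_form (l : {linear cplx L -> C}) (z : cplx L) : Re (l z) = form1 l z.1 + form2 l z.2.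
Proof.
case: z => p q; rewrite /form1 /form2 -[Re (l (p, 0))]mul1r -realify /=.
by congr (Re (l _)); congr pair => /=; rewrite ?scale1r ?addr0 ?add0r ?scaler0 ?addr0.
Qed.

Lemma continuous_form (l : L -> R) : linear_for *%R l -> continuous (fun v => l (vec_pow k v)).
Proof.
move=> ll; have l0 : l 0 = 0 by have := ll (-1) 0 0; rewrite scaler0 addr0 mulN1r addNr.
have lS (F : sym_idx m k -> R) : l (\sum_i F i *: sym_base i) = \sum_i F i * l (sym_base i).
  by elim/big_rec2: _ => [//|i x y _ <-]; rewrite ll.
have -> : (fun v => l (vec_pow k v)) = (fun v => \sum_i pow_coord i v * l (sym_base i)).
  by apply/funext => v; rewrite [X in l X]sym_coordE lS.
apply: smooth_continuous; apply: smooth_sum; first exact: openT.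
move=> i _; apply: smoothM; [exact: openT|exact: pow_coord_smooth|].
by apply: smooth_cst; exact: openT.
Qed.

(** In a chart of X the pushforward is a sum of two fiber integrals whose weights are real forms
    evaluated at v^k, so smoothness and bounds follow from the parametric integrals. *)
Lemma local_rep_push phi l : AX phi -> {in ccod phi, local_rep phi l (push f) =1
  fun y => fiber_int mu (fun v => form1 l (vec_pow k v)) (local_rep (pchart phi) (mulc 1) f) y
   + fiber_int mu (fun v => form2 l (vec_pow k v)) (local_rep (pchart phi) (mulc (- 'i)%C) f) y}.
Proof.
move=> Aphi y _; rewrite /local_rep Re_form /=.
rewrite (linear_moment hmu (form1_linear l) (supported_Re _)).
rewrite (linear_moment hmu (form2_linear l) (supported_Im _)).
congr (_ + _); congr haar_int; apply/funext => v; rewrite /= col_mxKu col_mxKd.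
  by rewrite Re_mulc1.
by rewrite Re_mulcNi.
Qed.

Lemma smooth_local_rep_push phi l : AX phi ->
  @smooth_on R _ R^o (ccod phi) (local_rep phi l (push f)).
Proof.
move=> Aphi; have oc := open_ccod Aphi.
have s1 := fiber_int_smooth hmu oc compact_snd (continuous_form (form1_linear l))
  (pchart_fiber_smooth 1 Aphi).
have s2 := fiber_int_smooth hmu oc compact_snd (continuous_form (form2_linear l))
  (pchart_fiber_smooth (- 'i)%C Aphi).
apply: (smooth_eq oc _ (smoothD oc s1 s2)) => y py.
by rewrite (local_rep_push l Aphi).
Qed.

Lemma test_function_push : test_function AX setT (push f).
Proof.
split; first by move=> phi l; exact: smooth_local_rep_push.
exists (fst @` K); split => //; last exact: push_off.
by apply: continuous_compact => //; apply: continuous_subspaceT => p; exact: cvg_fst.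
Qed.

End Support.

(** M depends on K and l, but not on the chart, the directions or the function: derivatives along X
    pass under the integral and only the weights are estimated. *)
Lemma push_dirD_bound (K : set (X * V)) (l : {linear cplx L -> C}) : compact K ->
  exists2 M : R, 0 <= M & forall O f phi vs (e : R) y, test_function AV O f ->
    vanishes_off K f -> AX phi -> ccod phi y -> 0 <= e ->
    (forall c v, c = 1 \/ c = (- 'i)%C -> (snd @` K) v ->
      `|dirD [seq col_mx u 0 | u <- vs] (local_rep (pchart phi) (mulc c) f) (col_mx y v)| <= e) ->
    `|dirD vs (local_rep phi l (push f)) y| <= e * M.
Proof.
move=> cK; have cK2 := compact_snd cK.
have c1 := continuous_form (form1_linear l).
have c2 := continuous_form (form2_linear l).
have [M1 M10 h1] := haar_int_mul_bound hmu cK2 c1.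
have [M2 M20 h2] := haar_int_mul_bound hmu cK2 c2.
exists (M1 + M2); first exact: addr_ge0.
move=> O f phi vs e y tf fK Aphi py e0 he; have oc := open_ccod Aphi.
have E := local_rep_push cK tf fK l Aphi.
have s1 := pchart_fiber_smooth tf fK 1 Aphi.
have s2 := pchart_fiber_smooth tf fK (- 'i)%C Aphi.
have S1 := fiber_int_smooth hmu oc cK2 c1 s1.
have S2 := fiber_int_smooth hmu oc cK2 c2 s2.
rewrite (dirD_eq vs oc E) ?inE// (dirDD vs oc S1 S2 py).
rewrite (dirD_fiber_int hmu oc cK2 c1 _ s1 py) (dirD_fiber_int hmu oc cK2 c2 _ s2 py).
rewrite (le_trans (ler_normD _ _))// mulrDr lerD//.
  apply: (h1 _ e (fiber_supported cK2 (fiber_smooth_dirD oc vs s1) py)) => // v Kv.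
  by apply: he => //; left.
apply: (h2 _ e (fiber_supported cK2 (fiber_smooth_dirD oc vs s2) py)) => // v Kv.
by apply: he => //; right.
Qed.

End Pushforward.

(** * The vector space of test functions *)

Section TestFunctions.
Context {R : realType} {T : topologicalType} {n : nat}.
Variables (A : set (chart R T n)) (O : set T) (E : lmodType R[i]).
Hypothesis openA : forall phi, A phi -> open (ccod phi).
Implicit Types f g : T -> E.

(** Only real parts are seen by [local_rep], so a complex scalar is absorbed into the form instead
    of being pulled out. *)
Lemma local_repP (phi : chart R T n) (l : {linear E -> R[i]^o}) (c : R[i]) f g :
  local_rep phi l (c *: f + g) = fun y => local_rep phi (mulc c \o l) f y + local_rep phi l g y.
Proof.
apply/funext => y; rewrite /local_rep /= linearP /mulc.
set z := l (f (cinv phi y)); set w := l (g (cinv phi y)).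
by case: c z w => a b [x x'] [u u'].
Qed.

Lemma test_function_lin (c : R[i]) f g : test_function A O f -> test_function A O g ->
  test_function A O (c *: f + g).
Proof.
move=> [sf [K [cK KO fK]]] [sg [K' [cK' KO' gK']]]; split.
  move=> phi l Aphi; rewrite local_repP; apply: smoothD; first exact: openA.
    exact: sf.
  exact: sg.
exists (K `|` K'); split; first exact: compactU.
  by move=> x [/KO|/KO'].
move=> x nK; rewrite /GRing.add /GRing.scale /= fK ?gK' ?scaler0 ?addr0//.
  by move=> Kx; apply: nK; right.
by move=> Kx; apply: nK; left.
Qed.

Lemma test_function0 : test_function A O (0 : T -> E).
Proof.
split=> [phi l Aphi|].
  apply: (smooth_eq (openA Aphi) _ (smooth_cst 0 (openA Aphi))) => y _.
  by rewrite /local_rep linear0.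
exists set0; split => //; first by move=> F FF F0; have := @filter_not_empty _ F FF.
Qed.

End TestFunctions.

(** * Continuity of the pushforward and pullback of distributions *)

Section PushDistribution.
Context {R : realType} (m k : nat).
Local Notation V := 'cV[R]_m.
Local Notation L := (Sym R m k).
Local Notation C := (R[i]^o).
Local Notation Re := complex.Re.
Local Notation Im := complex.Im.
Context {X : topologicalType} (n : nat) (AX : set (chart R X n)).
Hypothesis hX : smooth_manifold AX.
Local Notation AV := (prod_atlas AX (euclid_atlas R m)).
Variable mu : {measure set (borelV R m) -> \bar R}.
Hypothesis hmu : is_haar mu.
Variable O : set (X * V).
Local Notation push := (push k mu).

Lemma prod_atlas_euclid chi : AV chi -> exists2 phi, AX phi & chi = pchart m phi.
Proof. by move=> [phi [psi [Aphi -> ->]]]; exists phi. Qed.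

Lemma open_pchart chi : AV chi -> open (ccod chi).
Proof.
move=> /prod_atlas_euclid[phi Aphi ->]; rewrite pchart_cod.
have /continuousP/(_ _ (open_ccod hX Aphi)) := @continuous_usubmx R n m.
exact.
Qed.

Lemma push_lin (c : R[i]) (f g : X * V -> C) :
  test_function AV O f -> test_function AV O g ->
  push (c *: f + g) = c *: push f + push g.
Proof.
move=> tf tg; have [_ [K [cK _ fK]]] := tf; have [_ [K' [cK' _ gK]]] := tg.
have cKK := compactU cK cK'.
have fU : vanishes_off (K `|` K') f by move=> x nK; apply: fK => Kx; apply: nK; left.
have gU : vanishes_off (K `|` K') g by move=> x nK; apply: gK => Kx; apply: nK; right.
apply/funext => x.
have f1 := supported_Re hX cKK tf fU x; have f2 := supported_Im hX cKK tf fU x.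
have g1 := supported_Re hX cKK tg gU x; have g2 := supported_Im hX cKK tg gU x.
have -> : push (c *: f + g) x =
  (moment k mu (fun v => Re c * Re (f (x, v)) + (- Im c * Im (f (x, v)) + Re (g (x, v)))),
   moment k mu (fun v => Re c * Im (f (x, v)) + (Im c * Re (f (x, v)) + Im (g (x, v))))).
  have ReE (b z w : R[i]) : Re (b * z + w) = Re b * Re z + (- Im b * Im z + Re w).
    by case: b z w => b1 b2 [z1 z2] [w1 w2] /=; ring.
  have ImE (b z w : R[i]) : Im (b * z + w) = Re b * Im z + (Im b * Re z + Im w).
    by case: b z w => b1 b2 [z1 z2] [w1 w2] /=; ring.
  by rewrite /push; congr (moment _ _ _, moment _ _ _); apply/funext => v; rewrite -?ReE -?ImE.
rewrite (momentD k hmu _ f1 (supportedD _ f2 g1)) (momentD k hmu _ f2 g1).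
rewrite (momentD k hmu _ f2 (supportedD _ f1 g2)) (momentD k hmu _ f1 g2).
congr pair; rewrite /= addrA; congr (_ + _).
by rewrite scaleNr.
Qed.

Lemma push0 : push (0 : X * V -> C) = 0.
Proof.
by apply/funext => x; rewrite /push /= moment0.
Qed.

Lemma pushZ (c : R[i]) (f : X * V -> C) : test_function AV O f -> push (c *: f) = c *: push f.
Proof.
move=> tf; have := push_lin c tf (test_function0 O C open_pchart).
by rewrite addr0 push0 addr0.
Qed.

Lemma pushD (f g : X * V -> C) : test_function AV O f -> test_function AV O g ->
  push (f + g) = push f + push g.
Proof. by move=> tf tg; have := push_lin 1 tf tg; rewrite !scale1r. Qed.

Lemma push_test_function (f : X * V -> C) :
  test_function AV O f -> test_function AX setT (push f).
Proof.
by move=> tf; have [_ [K [cK _ fK]]] := tf; exact: (test_function_push k hX hmu cK tf fK).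
Qed.

(** Continuity of [push] at 0. Functions supported in K are pushed to functions supported in its
    projection to X. Each of the N seminorms there is controlled by two seminorms of f, for its real
    and imaginary parts, over the product of the projection of K to V with the compact set of the
    seminorm. *)
Lemma test_nbhs0_push W : test_nbhs0 AX setT W ->
  test_nbhs0 AV O [set h | test_function AV O h /\ W (push h)].
Proof.
move=> [B [BW aB hB]].
(* Membership includes being a test function, because absolute convexity relies on the linearity of
   [push], established for test functions. *)
exists [set h | test_function AV O h /\ B (push h)]; split.
- by move=> h [th Bh]; split => //; exact: BW.
- move=> f g a b [tf Bf] [tg Bg] ab; have tbg := test_function_lin open_pchart b tg
    (test_function0 O C open_pchart).
  rewrite addr0 in tbg; split; first exact: (test_function_lin open_pchart a tf tbg).
  by rewrite (push_lin _ tf tbg) (pushZ _ tg); exact: aB.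
move=> K cK KO; have cK1 : compact (fst @` K).
  by apply: continuous_compact => //; apply: continuous_subspaceT => p; exact: cvg_fst.
have cK2 := compact_snd cK.
have [N [q [e [hq e0 hN]]]] := hB (fst @` K) cK1 (@subsetT _ _).
have /choice[M hM] : forall j, exists M : R, 0 <= M /\ forall O f phi vs (e : R) y,
    test_function AV O f ->
    vanishes_off K f -> AX phi -> ccod phi y -> 0 <= e ->
    (forall c v, c = 1 \/ c = (- 'i)%C -> (snd @` K) v ->
      `|dirD [seq col_mx u 0 | u <- vs] (local_rep (pchart m phi) (mulc c) f) (col_mx y v)|
          <= e) ->
    `|dirD vs (local_rep phi (sn_form (q j)) (push f)) y| <= e * M.
  by move=> j; have [M M0 h] := push_dirD_bound hX hmu (sn_form (q j)) cK; exists M.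
(* S exceeds every M_j, so the tolerance e / S yields strict bounds; the summand 1 keeps S positive
   when all M_j vanish. *)
pose S := 1 + \sum_j M j; have S0 : 0 < S.
  by rewrite ltr_pwDl// sumr_ge0// => j _; have [] := hM j.
have MS j : M j < S.
  rewrite /S (bigD1 j)//= addrCA ltrDl ltr_pwDl// sumr_ge0// => i _.
  by have [] := hM i.
pose qc (c : R[i]) j : seminorm C := Seminorm (pchart m (sn_chart (q j)))
   ((fun p : V * 'cV[R]_n => col_mx p.2 p.1 : 'cV[R]_(n + m)) @` (snd @` K `*` sn_set (q j)))
   (mulc c) [seq col_mx u 0 | u <- sn_dirs (q j)].
pose q' (i : 'I_(N + N)) := match fintype.split i with
  | inl j => qc 1 j | inr j => qc (- 'i)%C j end.
have qcP c j : is_seminorm AV (qc c j).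
  have [Aj cj sj] := hq j; split; first exact: pchart_atlas.
    apply: continuous_compact; last exact: compact_setX.
    by apply: continuous_subspaceT; exact: continuous_col_mx.
  by move=> _ [[v y] [Kv yj] <-]; rewrite pchart_cod /= col_mxKu; exact: sj.
exists (N + N)%N, q', (e / S); split; first by move=> i; rewrite /q'; case: fintype.split.
  exact: divr_gt0.
move=> f tf fK small; split => //; apply: hN.
- exact: push_test_function.
- exact: push_off.
move=> j y yj; have [Aj cj sj] := hq j; have [M0 h] := hM j.
apply: (@le_lt_trans _ _ (e / S * M j)).
  apply: (h O) => //; first exact: sj.
    by rewrite ltW// divr_gt0.
  move=> c v [->|->] Kv; apply: ltW.
    have := small (unsplit (inl j)); rewrite /q' unsplitK; apply.
    by exists (v, y).
  have := small (unsplit (inr j)); rewrite /q' unsplitK; apply.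
  by exists (v, y).
by rewrite mulrAC ltr_pdivrMr// ltr_pM2l.
Qed.

Lemma distribution_push (xi : (X -> cplx L) -> R[i]) :
  Defs.distribution AX setT xi -> Defs.distribution AV O (fun f => xi (push f)).
Proof.
move=> [lxi cxi]; split.
  move=> f g c tf tg; rewrite (push_lin c tf tg) lxi//; exact: push_test_function.
move=> f tf e e0.
have [B [BW aB hB]] := test_nbhs0_push (cxi _ (push_test_function tf) e e0).
exists B; split => // h /BW [th [_ W]]; split => //=.
by rewrite (pushD tf th).
Qed.

End PushDistribution.

(** * Surjectivity and equivariance of the fiber integral *)

Section Tensor.
Context {R : realType} (m k : nat).
Local Notation V := 'cV[R]_m.
Local Notation L := (Sym R m k).
Local Notation C := (R[i]^o).
Local Notation Re := complex.Re.
Local Notation Im := complex.Im.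
Local Notation I := (sym_idx m k).
Context {X : topologicalType} (n : nat) (AX : set (chart R X n)).
Hypothesis hX : smooth_manifold AX.
Local Notation AV := (prod_atlas AX (euclid_atlas R m)).
Variable mu : {measure set (borelV R m) -> \bar R}.
Hypothesis hmu : is_haar mu.

Definition cplx_coord (i : I) (z : cplx L) : C :=
  (sym_coord i z.1 +i* sym_coord i z.2)%C.

Lemma cplx_coord_linear i : linear (cplx_coord i).
Proof.
move=> c z w; have sc (a b : R) (p q r : L) :
    sym_coord i (a *: p + (b *: q + r)) = a * sym_coord i p + (b * sym_coord i q + sym_coord i r).
  by rewrite !sym_coord_linear.
rewrite /cplx_coord /= -scaleNr -!addrA !sc /GRing.scale /=.
case: c => a b; apply/eqP; rewrite eq_complex /=.
by apply/andP; split; apply/eqP; ring.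
Qed.

HB.instance Definition _ i :=
  GRing.isLinear.Build R[i] (cplx L) C _ (cplx_coord i) (cplx_coord_linear i).

Definition tensor (phi : I -> V -> R^o) (f : X -> cplx L) (p : X * V) : C :=
  \sum_i (phi i p.2 : R)%:C * cplx_coord i (f p.1).

Lemma linear_mulr (l : {linear C -> C}) (c z : R[i]) : l (c * z) = c * l z.
Proof. exact: (linearZ_LR l c z). Qed.

Lemma Re_real_mul (a : R) (z : R[i]) : Re (a%:C * z) = a * Re z.
Proof. by case: z => x y /=; rewrite mul0r subr0. Qed.

Lemma Im_real_mul (a : R) (z : R[i]) : Im (a%:C * z) = a * Im z.
Proof. by case: z => x y /=; rewrite mul0r addr0. Qed.

Lemma push_tensor (phi : I -> V -> R^o) K f : (forall i, supported K (phi i)) -> compact K ->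
  (forall i j, haar_int mu (fun v => (phi i v : R) * pow_coord j v) = (i == j)%:R) ->
  push k mu (tensor phi f) = f.
Proof.
move=> sphi cK dual; apply/funext => x; rewrite /push.
(* By duality the combination of the phi_i with coefficients a_i has moment with coordinates a_i;
   this is used for the real and imaginary parts separately. *)
have mom (a : I -> R) : moment k mu (fun v => \sum_i a i * phi i v) =
    \sum_i a i *: sym_base i.
  have [sS _] := haar_int_sum hmu (index_enum I) a cK sphi.
  apply: sym_coord_inj => j; rewrite (sym_coord_moment hmu j sS).
  have [_] := haar_int_sum hmu (index_enum I) a cK (fun i => supported_pow j (sphi i)).
  rewrite (_ : (fun v => _) = (fun v => (\sum_i a i * phi i v) * pow_coord j v)) => [->|]; last first.
    by apply/funext => v; rewrite mulr_suml; apply: eq_bigr => i _; rewrite mulrA.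
  have lin := @sym_coord_linear R m k j.
  have sc0 : sym_coord j (0 : L) = 0.
    by have := lin (-1) 0 0; rewrite scaler0 addr0 mulN1r addNr.
  have -> : sym_coord j (\sum_i a i *: sym_base i : L) = \sum_i a i * sym_coord j (sym_base i : L).
    by elim/big_rec2: _ => [//|i y z _ <-]; rewrite lin.
  by apply: eq_bigr => i _; rewrite sym_coord_base dual eq_sym.
case E : (f x) => [p q].
rewrite [in RHS](sym_coordE p) [in RHS](sym_coordE q) -!mom.
congr (moment _ _ _, moment _ _ _); apply/funext => v; rewrite /tensor raddf_sum;
  apply: eq_bigr => i _.
  by rewrite [LHS]Re_real_mul /= E mulrC.
by rewrite [LHS]Im_real_mul /= E mulrC.
Qed.

Lemma test_function_tensor (U : set V) (phi : I -> V -> R^o) K f :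
  (forall i, @smooth_on R _ R^o setT (phi i)) -> compact K -> K `<=` U ->
  (forall i, supported K (phi i)) ->
  test_function AX setT f -> test_function AV (setT `*` U) (tensor phi f).
Proof.
move=> sphi cK KU suppphi [sf [Kf [cKf _ f0]]]; split.
  move=> chi l /prod_atlas_euclid[psi Apsi ->]; rewrite pchart_cod.
  have oc := open_ccod hX Apsi.
  have oS : open [set z : 'cV[R]_(n + m) | ccod psi (usubmx z)].
    have /continuousP/(_ _ oc) := @continuous_usubmx R n m; exact.
  (* In a product chart each summand is a function of the lower block of z times a function of the
     upper block. *)
  pose F (z : 'cV[R]_(n + m)) : R^o := \sum_i (phi i (dsubmx z) : R) *
     local_rep psi (l \o cplx_coord i) f (usubmx z).
  apply: (smooth_eq oS (f := F)).
    move=> z _; rewrite /F /local_rep /tensor /= linear_sum raddf_sum /=.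
    apply: eq_bigr => i _; rewrite -Re_real_mul; congr Re.
    exact: esym (linear_mulr l _ _).
  apply: smooth_sum => // i _; apply: smoothM => //.
    have := @smooth_mulmx _ _ _ (row_mx 0 1%:M : 'M[R]_(m, n + m)) _ _ openT (sphi i).
    have E (z : 'cV[R]_(n + m)) : row_mx 0 1%:M *m z = dsubmx z :> 'cV[R]_m.
      by rewrite -{1}[z]vsubmxK mul_row_col mul0mx add0r mul1mx.
    under [X in smooth_on _ X]funext do rewrite E.
    exact: smooth_sub.
  have := @smooth_mulmx _ _ _ (row_mx 1%:M 0 : 'M[R]_(n, n + m)) _ _ oc (sf psi (l \o cplx_coord i) Apsi).
  have E (z : 'cV[R]_(n + m)) : row_mx 1%:M 0 *m z = usubmx z :> 'cV[R]_n.
    by rewrite -{1}[z]vsubmxK mul_row_col mul0mx addr0 mul1mx.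
  under [X in smooth_on _ X]funext do rewrite E.
  by apply: smooth_sub => z /=; rewrite E.
exists (Kf `*` K); split; first exact: compact_setX.
  by move=> [x v] [_ /KU].
move=> [x v] nK; rewrite /tensor big1// => i _ /=.
have [Kx|nKx] := pselect (Kf x); last by rewrite f0// linear0 mulr0.
have [_ _ ->] := suppphi i; first by rewrite mul0r.
by move=> Kv; apply: nK.
Qed.

End Tensor.

(** At x the left side integrates f (g^-1 x, g^-1 v) v^k over v; [moment_mulmx] with A = rho(g^-1)
    and B = rho(g) moves g onto v^k. *)
Lemma push_act (R : realType) (m k : nat) (G : groupTopologicalType) (X : topologicalType)
    (n : nat) (AX : set (chart R X n)) (hX : smooth_manifold AX)
    (mu : {measure set (borelV R m) -> \bar R}) (hmu : is_haar mu)
    (a : G -> X -> X) (rho : G -> 'M[R]_m) (hrho : representation rho)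
    (hpres : preserves_measure rho mu) (O : set (X * 'cV[R]_m)) g (f : X * 'cV[R]_m -> R[i]^o) :
  test_function (prod_atlas AX (euclid_atlas R m)) O f ->
  push k mu (act_fun (fun g p => (a g p.1, rho g *m p.2)) (fun _ z => z) g f) =
  act_fun a (fun g => cplx_map (@sym_map R m k (rho g))) g (push k mu f).
Proof.
move=> tf; have [_ [K [cK _ fK]]] := tf; have [rho1 rhoM _] := hrho.
have AB : rho g^-1%g *m rho g = 1%:M by rewrite -rhoM mulVg rho1.
have BA : rho g *m rho g^-1%g = 1%:M by rewrite -rhoM mulgV rho1.
apply/funext => x; rewrite /act_fun /push /cplx_map /=; congr pair.
  exact: (moment_mulmx k hmu AB BA (hpres g) (supported_Re hX cK tf fK _)).
exact: (moment_mulmx k hmu AB BA (hpres g) (supported_Im hX cK tf fK _)).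
Qed.

Unset Implicit Arguments.
Set Strict Implicit.
Set Printing Implicit Defensive.

Theorem proposition4p3p1 (R : realType)
  (G : groupTopologicalType) (d : nat) (AG : set (chart R G d))
  (hG : lie_group AG)
  (X : topologicalType) (n : nat) (AX : set (chart R X n))
  (hX : smooth_manifold AX)
  (a : G -> X -> X) (ha : smooth_action AG AX a)
  (m : nat) (rho : G -> 'M[R]_m) (hrho : representation rho)
  (mu : {measure set (borelV R m) -> \bar R}) (hmu : is_haar mu)
  (hpres : preserves_measure rho mu)
  (U : set 'cV[R]_m) (hUopen : open U) (hU0 : U !=set0)
  (hUinv : forall (g : G) (v : 'cV[R]_m), U v -> U (rho g *m v))
  (chi : G -> R[i]) (hchi : is_character chi)
  (hXU : equivariant_distributions_vanish
    (prod_atlas AX (euclid_atlas R m)) (setT `*` U)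
    (fun (g : G) (p : X * 'cV[R]_m) => (a g p.1, rho g *m p.2))
    (fun (_ : G) (z : R[i]^o) => z) chi) :
  forall k : nat,
    equivariant_distributions_vanish AX setT a
      (fun (g : G) => cplx_map (@sym_map R m k (rho g))) chi.
Proof.
move=> k xi [dxi exi] f tf.
have [phi [K [cK KU sphi suppphi dual]]] := dual_bumps k hmu hUopen hU0.
pose eta F := xi (push k mu F).
have eta_equiv : equivariant_distributions
    (prod_atlas AX (euclid_atlas R m)) (setT `*` U)
    (fun (g : G) (p : X * 'cV[R]_m) => (a g p.1, rho g *m p.2))
    (fun (_ : G) (z : R[i]^o) => z) chi eta.
  split; first exact: distribution_push.
  (* The distribution action lets g^-1 act on F; [push_act] moves it past [push], where the
     equivariance of xi applies. *)
  move=> g F tF; rewrite /act_dist /eta (push_act k hX hmu a hrho hpres _ tF).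
  exact: exi (push_test_function k hX hmu tF).
have := hXU eta eta_equiv _ (test_function_tensor hX sphi cK KU suppphi tf).
by rewrite /eta (push_tensor hmu f suppphi cK dual).
Qed.
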